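(* Let $\Omega\subset\mathbb{R}^n$ be a bounded domain and $1<p<\infty$. Let $v$ be a weight on $\Omega$ with $v\in L^1(\Omega)$, let $Q$ be a measurable, symmetric, nonnegative definite $n\times n$ matrix function on $\Omega$ with $|Q(x)|_{\mathrm{op}}^{p/2}\le k\,v(x)$ for a.e. $x\in\Omega$ (some constant $k$), and let $\mathbf t\cdot\nabla$ be a degenerate subunit vector field on $\Omega$. Suppose that the Sobolev inequality $$\|\varphi\|_{L^N(v,\Omega)}\le S_N\|\nabla\varphi\|_{QL^p(\Omega)}\qquad\text{for all }\varphi\in \mathrm{Lip}_0(\Omega)$$ holds with $N(t)=t^p\log(e+t)^p$. Let $f,g\in L^\infty(v,\Omega)$. Let $r>0$ and $H(t)=t^r\exp(t)$. Then there is a constant $C$, depending only on $H,\mathbf t,p,S_N,\Omega,v$, such that every degenerate weak subsolution $u\in QH^{1,p}_0(v,\Omega)$ of the Dirichlet problem (D) (see context) satisfies $$\|u^+\|_{L^H(v,\Omega)}\le C\big(\|f\|_{L^\infty(v,\Omega)}+\|g\|_{L^\infty(v,\Omega)}\big),$$ and every degenerate weak supersolution $u\in QH^{1,p}_0(v,\Omega)$ of (D) satisfies the same bound with $u^-$ in place of $u^+$. In particular, if $u$ is a degenerate weak solution of (D), then $u\in L^H(v,\Omega)$ with this bound (with a constant having the same dependence).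
   Context: A weight $v$ is a nonnegative measurable function; $v(E)=\int_E v\,dx$. $L^p(v,\Omega)$ is the Lebesgue space with respect to the measure $v\,dx$, and $\|\cdot\|_{L^\infty(v,\Omega)}$ is the essential supremum with respect to $v\,dx$. For an increasing function $\Phi:[0,\infty)\to[0,\infty)$ with $\Phi(0)=0$, $\|h\|_{L^\Phi(v,\Omega)}=\inf\{\lambda>0:\int_\Omega \Phi(|h|/\lambda)\,v\,dx\le 1\}$, and $L^\Phi(v,\Omega)$ is the set of measurable $h:\Omega\to\mathbb{R}$ for which this is finite. $\mathrm{Lip}_0(\Omega)$ is the set of locally Lipschitz functions with compact support in $\Omega$. $QL^p(\Omega)$ is the space of measurable $\mathbf g:\Omega\to\mathbb{R}^n$ with $\|\mathbf g\|_{QL^p(\Omega)}=(\int_\Omega|\sqrt{Q}\,\mathbf g|^p\,dx)^{1/p}<\infty$, with functions identified when their difference has norm $0$. $QH^{1,p}_0(v,\Omega)$ is the completion of $\mathrm{Lip}_0(\Omega)$ in the norm $\|\psi\|_{L^p(v,\Omega)}+\|\nabla\psi\|_{QL^p(\Omega)}$; its elements are identified with pairs $(u,\nabla u)\in L^p(v,\Omega)\times QL^p(\Omega)$ that are limits in $L^p(v,\Omega)\times QL^p(\Omega)$ of sequences $(\psi_j,\nabla\psi_j)$ with $\psi_j\in\mathrm{Lip}_0(\Omega)$. Here ''$\nabla u$'' is notation for the second component (it need not be a classical weak gradient), and one writes $u\in QH^{1,p}_0(v,\Omega)$ for the pair. For measurable $\mathbf t:\Omega\to\mathbb{R}^n$,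 $\mathbf t\cdot\nabla$ is a degenerate subunit vector field if there is a constant $C(\mathbf t)>0$ with $\|\mathbf t\cdot\nabla\varphi\|_{L^p(v,\Omega)}\le C(\mathbf t)\|\nabla\varphi\|_{QL^p(\Omega)}$ for every $\varphi\in\mathrm{Lip}_0(\Omega)$. Dependence of a constant on $\mathbf t$ includes dependence on $C(\mathbf t)$. The Dirichlet problem (D) is, formally, $$-v^{-1}\mathrm{div}(|\sqrt Q\nabla u|^{p-2}Q\nabla u)=f|f|^{p-2}-v^{-1}\mathrm{div}(v|g|^{p-2}g\,\mathbf t)\ \text{in }\Omega,\qquad u=0\text{ on }\partial\Omega,$$ with $f,g$ real-valued measurable functions. A pair $(u,\nabla u)\in QH^{1,p}_0(v,\Omega)$ is a degenerate weak solution of (D) if $$\int_\Omega|\sqrt Q\nabla u|^{p-2}\,\nabla\varphi\cdot Q\nabla u\,dx=\int_\Omega\big(f|f|^{p-2}\varphi+|g|^{p-2}g\,\mathbf t\cdot\nabla\varphi\big)\,v\,dx$$ for every $\varphi\in\mathrm{Lip}_0(\Omega)$. It is a degenerate weak subsolution (supersolution) if this holds with ''$=$'' replaced by ''$\le$'' (''$\ge$'') for every nonnegative $\varphi\in\mathrm{Lip}_0(\Omega)$. Expressions $|w|^{p-2}w$ are $0$ where $w=0$. Finally $u^+=\max(u,0)$, $u^-=\max(-u,0)$. *)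

(* Defs.v *)
From HB Require Import structures.
From mathcomp Require Import all_boot all_order all_algebra.
From mathcomp Require Import all_classical all_reals all_analysis.

Set Implicit Arguments.
Unset Strict Implicit.
Unset Printing Implicit Defensive.

Import Order.TTheory GRing.Theory Num.Def Num.Theory.
Import numFieldNormedType.Exports.

Local Open Scope classical_set_scope.
Local Open Scope ring_scope.

(* Points and vectors of R^d, d >= 1, are row vectors 'rV[R]_n.+1, d = n.+1.
   The norm and topology MathComp-Analysis puts on them come from the sup norm;
   the Euclidean norm is [enorm] below. *)

Section lebesgue_outer_measure.
Variables (R : realType) (n : nat).
Local Notation V := 'rV[R]_n.+1.

Definition box (I : V * V) : set V :=
  [set x | forall i, I.1 0 i < x 0 i <= I.2 0 i].

Definition box_vol (I : V * V) : R := \prod_i (I.2 0 i - I.1 0 i).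

Definition box_cover (A : set V) : set (nat -> V * V) :=
  [set F : nat -> V * V | (forall k i, (F k).1 0 i <= (F k).2 0 i) /\
           A `<=` \bigcup_k box (F k)].

Definition leb_outer (A : set V) : \bar R :=
  ereal_inf [set (\sum_(k <oo) (box_vol (F k))%:E)%E | F in box_cover A].

Lemma box_vol_ge0 A F k : box_cover A F -> (0 <= (box_vol (F k))%:E)%E.
Proof.
by case=> + _ => /(_ k) F0; rewrite lee_fin prodr_ge0// => i _; rewrite subr_ge0.
Qed.

Lemma leb_outer_ge0 A : (0 <= leb_outer A)%E.
Proof.
apply: le_ereal_inf_tmp => _ [F AF <-].
by apply: nneseries_ge0 => k _ _; exact: box_vol_ge0 AF.
Qed.

Lemma le_leb_outer : {homo leb_outer : A B / A `<=` B >-> (A <= B)%E}.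
Proof.
move=> A B AB; apply: ereal_inf_le_tmp => _ [F [F0 BF] <-].
by exists F => //; split => //; exact: subset_trans BF.
Qed.

Lemma leb_outer0 : leb_outer set0 = 0%E.
Proof.
apply/eqP; rewrite eq_le leb_outer_ge0 andbT.
apply: ereal_inf_lbound; exists (fun=> (0, 0)); first by split.
apply: eseries0 => k _ _.
by rewrite /box_vol big_ord_recl /= mxE subrr mul0r.
Qed.

Lemma leb_outer_sigma_subadditive : sigma_subadditive leb_outer.
Proof.
move=> A; have [[i ioo]|] := pselect (exists i, leb_outer (A i) = +oo%E).
  rewrite (eseries_pinfty _ _ ioo) ?leey// => k _.
  by rewrite -ltNye (lt_le_trans _ (leb_outer_ge0 _)).
rewrite -forallNE => Aoo; apply/lee_addgt0Pr => e e0.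
rewrite (le_trans _ (epsilon_trick _ _ (ltW e0)))//; last first.
  by move=> k; exact: leb_outer_ge0.
pose vol I : \bar R := (box_vol I)%:E.
pose P k (B : nat -> V * V) := box_cover (A k) B /\
  (\sum_(j <oo) vol (B j) <= leb_outer (A k) + (e / (2 ^ k.+1)%:R)%:E)%E.
have [G PG] : {G : nat -> nat -> V * V & forall k, P k (G k)}.
  apply: (@choice _ _ P) => k; rewrite /P /leb_outer.
  set S := (X in ereal_inf X); move infS : (ereal_inf S) => iS.
  case: iS infS => [r Sr|Soo|Soo].
  - have en1 : 0 < e / (2 ^ k.+1)%:R by rewrite divr_gt0// ltr0n expn_gt0.
    have /(lb_ereal_inf_adherent en1) : ereal_inf S \is a fin_num by rewrite Sr.
    move=> [x [B AB muBx] xS].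
    by exists B; split => //; rewrite muBx -Sr; exact/ltW.
  - by have := Aoo k; rewrite /leb_outer Soo.
  - by have := leb_outer_ge0 (A k); rewrite /leb_outer -/S Soo.
have G0 x : (0 <= (vol \o uncurry G) x)%E.
  by case: x => i j; exact: box_vol_ge0 (PG i).1.
apply: (@le_trans _ _ (\esum_(i in setT) (vol \o uncurry G) i)%E).
  apply: ereal_inf_lbound => /=.
  have /card_esym/ppcard_eqP[f] := card_nat2.
  exists (uncurry G \o f).
    split => [k i|].
      by rewrite /=; case: (f k) => a b; exact: (PG a).1.1.
    move=> x [i _ Aix]; have [j _ Bij] := (PG i).1.2 x Aix.
    by exists (f^-1%FUN (i, j)) => //=; rewrite invK ?inE.
  rewrite -(esum_pred_image (vol \o uncurry G) _ xpredT) ?[fun=> _]set_true//.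
  by rewrite image_eq.
rewrite (_ : esum _ _ = \sum_(i <oo) \sum_(j <oo ) vol (G i j))%E; last first.
  pose J : nat -> set (nat * nat) := fun i => [set (i, j) | j in setT].
  rewrite (_ : setT = \bigcup_k J k); last first.
    by rewrite predeqE => -[a b]; split => // _; exists a => //; exists b.
  rewrite esum_bigcupT /=; last 2 first.
    - apply/trivIsetP => i j _ _ ij.
      rewrite predeqE => -[k m] /=; split => //= -[] [_] _ [<-{k} _].
      by move=> [m' _] [] /esym/eqP; rewrite (negbTE ij).
    - by move=> x; exact: G0.
  rewrite -(image_id [set: nat]) -fun_true esum_pred_image//; last first.
    by move=> k _; apply: esum_ge0 => x _; exact: G0.
  apply: eq_eseriesr => j _ /=.
  rewrite -(esum_pred_image (vol \o uncurry G) (pair j) predT)//=; last first.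
  - by move=> ? ? _ _; exact: (@can_inj _ _ _ snd).
  - by move=> k _; exact: (G0 (j, k)).
  by congr esum; rewrite predeqE => -[a b]; split; move=> [i _ <-]; exists i.
apply: lee_lim.
- apply: is_cvg_nneseries => k *.
  by apply: nneseries_ge0 => m *; exact: (G0 (k, m)).
- apply: is_cvg_nneseries => k *; apply: adde_ge0; first exact: leb_outer_ge0.
  by rewrite lee_fin divr_ge0// ltW.
- by near=> m; apply: lee_sum => i _; exact: (PG i).2.
Unshelve. all: by end_near. Qed.

HB.instance Definition _ := isOuterMeasure.Build R V leb_outer
  leb_outer0 leb_outer_ge0 le_leb_outer leb_outer_sigma_subadditive.

Definition leb_outer_measure : {outer_measure set V -> \bar R} := leb_outer.

(* 'rV[R]_n.+1 with the (complete) sigma-algebra of Lebesgue measurable sets,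
   i.e. the Caratheodory measurable sets of [leb_outer]. *)
Local Notation lebT := (caratheodory_type leb_outer_measure).

Definition leb : {measure set lebT -> \bar R} :=
  [the measure _ _ of leb_outer_measure : set lebT -> \bar R].

End lebesgue_outer_measure.

Section linear_algebra.
Variables (R : realType) (m : nat).

Definition dotv (x y : 'rV[R]_m) : R := \sum_i x 0 i * y 0 i.

Definition enorm (x : 'rV[R]_m) : R := Num.sqrt (dotv x x).

(* The product A x of a matrix and a (row) vector. *)
Definition mulv (A : 'M[R]_m) (x : 'rV[R]_m) : 'rV[R]_m := x *m A^T.

Definition psd (A : 'M[R]_m) : Prop :=
  A^T = A /\ forall x, 0 <= dotv x (mulv A x).

(* The square root of a symmetric nonnegative definite A: the unique symmetric
   nonnegative definite S with S S = A (and the junk value 0 if A is not so). *)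
Definition sqrtmx (A : 'M[R]_m) : 'M[R]_m :=
  xget 0 [set S | psd S /\ S *m S = A].

Definition opnorm (A : 'M[R]_m) : R :=
  sup [set enorm (mulv A x) | x in [set x | enorm x <= 1]].

End linear_algebra.

Section spaces.
Variables (R : realType) (n : nat).
Local Notation V := 'rV[R]_n.+1.
Local Notation leb := (@leb R n).
Local Notation lebT := (caratheodory_type (@leb_outer_measure R n)).

(* A function on Omega is represented by a total function on R^d of which only
   the restriction to Omega matters. *)
Variable Omega : set V.

Definition domain : Prop := [/\ open Omega, connected Omega & Omega !=set0].

Definition measurable_on (h : V -> R) : Prop :=
  measurable_fun (Omega : set lebT) (h : lebT -> R).

Definition measurable_vec_on (g : V -> V) : Prop :=
  forall i, measurable_on (fun x => g x 0 i).

Definition measurable_mx_on (Q : V -> 'M[R]_n.+1) : Prop :=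
  forall i j, measurable_on (fun x => Q x i j).

Definition integral_on (h : V -> R) : \bar R :=
  \int[leb]_(x in (Omega : set lebT)) (h x)%:E.

Definition integrable_on (h : V -> R) : Prop :=
  leb.-integrable (Omega : set lebT) (fun x => (h x)%:E).

Definition weight (v : V -> R) : Prop :=
  measurable_on v /\ forall x, Omega x -> 0 <= v x.

Definition wmeas (v : V -> R) (E : set V) : \bar R :=
  \int[leb]_(x in (E : set lebT)) (v x)%:E.

Definition Lp_norm (v : V -> R) (p : R) (h : V -> R) : \bar R :=
  (integral_on (fun x => `|h x| `^ p * v x)%R `^ p^-1)%E.

Definition in_Lp (v : V -> R) (p : R) (h : V -> R) : Prop :=
  measurable_on h /\ (Lp_norm v p h < +oo)%E.

(* Essential supremum of |h| for the measure v dx; the bounds range over M >= 0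
   so that the norm is 0, not -oo, when v vanishes almost everywhere. *)
Definition Linf_norm (v : V -> R) (h : V -> R) : \bar R :=
  ereal_inf [set M%:E | M in
    [set M : R | 0 <= M /\ wmeas v (Omega `&` [set x | M < `|h x|]) = 0%E]].

Definition in_Linf (v : V -> R) (h : V -> R) : Prop :=
  measurable_on h /\ (Linf_norm v h < +oo)%E.

Definition LPhi_norm (v : V -> R) (Phi : R -> R) (h : V -> R) : \bar R :=
  ereal_inf [set l%:E | l in
    [set l : R | 0 < l /\
       (integral_on (fun x => Phi (`|h x| / l) * v x)%R <= 1)%E]].

Definition in_LPhi (v : V -> R) (Phi : R -> R) (h : V -> R) : Prop :=
  measurable_on h /\ (LPhi_norm v Phi h < +oo)%E.

(* Elements of Lip_0(Omega), extended by 0 to R^d. *)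
Definition Lip0 (phi : V -> R) : Prop :=
  [/\ [locally [lipschitz phi x | x in Omega]],
      compact (closure [set x | phi x != 0]) &
      closure [set x | phi x != 0] `<=` Omega].

(* The classical gradient, which exists almost everywhere for locally Lipschitz
   functions; a partial derivative is given a junk value where it does not
   exist. *)
Definition grad (phi : V -> R) (x : V) : V :=
  \row_i 'D_'e_i phi x.

Definition QLp_norm (Q : V -> 'M[R]_n.+1) (p : R) (g : V -> V) : \bar R :=
  (integral_on (fun x => enorm (mulv (sqrtmx (Q x)) (g x)) `^ p)%R `^ p^-1)%E.

Definition in_QLp (Q : V -> 'M[R]_n.+1) (p : R) (g : V -> V) : Prop :=
  measurable_vec_on g /\ (QLp_norm Q p g < +oo)%E.

(* (u, du) represents an element of QH^{1,p}_0(v, Omega): du is the second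
   component of the pair, and need not be determined by u. *)
Definition in_QH10 (v : V -> R) (Q : V -> 'M[R]_n.+1) (p : R)
    (u : V -> R) (du : V -> V) : Prop :=
  [/\ in_Lp v p u, in_QLp Q p du &
   exists psi : nat -> V -> R,
     [/\ forall j, Lip0 (psi j),
         Lp_norm v p (fun x => psi j x - u x) @[j --> \oo] --> 0%E &
         QLp_norm Q p (fun x => grad (psi j) x - du x) @[j --> \oo] --> 0%E]].

(* The vector field t . grad is degenerate subunit with constant C(t) = Ct. *)
Definition subunit_field (v : V -> R) (Q : V -> 'M[R]_n.+1) (p : R)
    (t : V -> V) (Ct : R) : Prop :=
  [/\ measurable_vec_on t, 0 < Ct & forall phi, Lip0 phi ->
   (Lp_norm v p (fun x => dotv (t x) (grad phi x)) <=
    Ct%:E * QLp_norm Q p (grad phi))%E].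

Definition sobolev (v : V -> R) (Q : V -> 'M[R]_n.+1) (p : R) (N : R -> R)
    (SN : R) : Prop :=
  forall phi, Lip0 phi ->
   (LPhi_norm v N phi <= SN%:E * QLp_norm Q p (grad phi))%E.

Definition weak_lhs (Q : V -> 'M[R]_n.+1) (p : R) (du : V -> V)
    (phi : V -> R) : \bar R :=
  integral_on (fun x => enorm (mulv (sqrtmx (Q x)) (du x)) `^ (p - 2) *
                        dotv (grad phi x) (mulv (Q x) (du x))).

Definition weak_rhs (v : V -> R) (p : R) (t : V -> V) (f g : V -> R)
    (phi : V -> R) : \bar R :=
  integral_on (fun x => (f x * `|f x| `^ (p - 2) * phi x +
    `|g x| `^ (p - 2) * g x * dotv (t x) (grad phi x)) * v x).

Definition weak_solution (v : V -> R) (Q : V -> 'M[R]_n.+1) (p : R)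
    (t : V -> V) (f g : V -> R) (u : V -> R) (du : V -> V) : Prop :=
  in_QH10 v Q p u du /\ forall phi, Lip0 phi ->
    weak_lhs Q p du phi = weak_rhs v p t f g phi.

Definition weak_subsolution (v : V -> R) (Q : V -> 'M[R]_n.+1) (p : R)
    (t : V -> V) (f g : V -> R) (u : V -> R) (du : V -> V) : Prop :=
  in_QH10 v Q p u du /\ forall phi, Lip0 phi -> (forall x, 0 <= phi x) ->
    (weak_lhs Q p du phi <= weak_rhs v p t f g phi)%E.

Definition weak_supersolution (v : V -> R) (Q : V -> 'M[R]_n.+1) (p : R)
    (t : V -> V) (f g : V -> R) (u : V -> R) (du : V -> V) : Prop :=
  in_QH10 v Q p u du /\ forall phi, Lip0 phi -> (forall x, 0 <= phi x) ->
    (weak_rhs v p t f g phi <= weak_lhs Q p du phi)%E.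

End spaces.

Section growth_functions.
Variable R : realType.

Definition N_bump (p : R) (s : R) : R := s `^ p * ln (expR 1 + s) `^ p.

Definition H_exp (r : R) (s : R) : R := s `^ r * expR s.

End growth_functions.

(* Main.v *)
Require Import Defs.
From mathcomp Require Import all_boot all_order all_algebra.
From mathcomp Require Import complex ring lra.
From mathcomp Require Import all_classical all_reals all_analysis.
From mathcomp Require Import measurable_realfun.

Set Implicit Arguments.
Unset Strict Implicit.
Unset Printing Implicit Defensive.

Import Order.TTheory GRing.Theory Num.Def Num.Theory.
Import numFieldNormedType.Exports.

Local Open Scope classical_set_scope.
Local Open Scope ring_scope.

(* The logarithmic gain in the Sobolev inequality is not needed: N(s) >= s^p turns
   it into the Poincare inequality [int |phi|^p v <= S int |sqrt Q grad phi|^p],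
   and this already gives exponential integrability. Let M > |f| + |g| and test
   the equation with h(u), where h' = k^p, K' = k, and
   k(s) = c (exp(c min(s^+, T)) - 1) with c a small multiple of 1/M. Since
   h'(u) |sqrt Q grad u|^p = |sqrt Q grad K(u)|^p, Young's inequality and the
   subunit condition applied to K(u) bound [int |sqrt Q grad K(u)|^p] by
   [int (M^(p-1) h(u) + (M k(u))^p) v], which is at most
   C (cM)^(p-1) [int (1 + K(u))^p v] because M k <= 2 c M (1 + K) and
   h <= K k^(p-1). For cM small the Poincare inequality absorbs this and leaves
   [int K(u)^p v <= C v(Omega)] uniformly in T, hence a bound on
   [int exp(p c u^+) v].
   Since u is only a limit of Lip_0 functions psi, the equation is tested with
   h(psi) instead, and the error is controlled by [int |sqrt Q (grad psi - du)|^p]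
   because k is bounded. A supersolution u with data f, g is handled by -u with
   data -f, -g. *)

(** * The truncated exponential and its antiderivatives *)

(** Since [du] need not be a gradient of [u], there is no chain rule for the pair, and only Lip_0
    functions may be tested; this is why K and h are composed with psi. The pairing of grad psi with
    Q du is then no p-th power, and replacing it by |sqrt Q grad psi|^p costs an error weighted by
    k^p <= L^p. The truncation at T keeps k bounded: it makes [K \o psi] and [h \o psi] Lip_0, and
    makes the integral of K(psi)^p v finite, so that it may be absorbed. L grows with T, so psi
    tends to u before T tends to infinity. The constants are chosen in the order [e], [g], [m]. [e]
    is large in terms of [Ct], so that the t-term uses up at most half of the energy; g = 2 c M is
    small in terms of [e] and [SN], for the absorption; [m] is large in terms of v(Omega), to make
    the integral of H at most 1/2. The value 1/2 rather than 1 lets the bounds for u^+ and u^- be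
    added for a solution. Only g, not M, enters the smallness conditions, so c = g / (2 M) and the
    resulting norm bound is linear in M. *)

Section antiderivative.
Variable R : realType.

Lemma antiderivative (f : R -> R) :
  continuous f -> (forall s, s <= 0 -> f s = 0) ->
  exists F : R -> R, (forall s : R, is_derive s 1 F (f s)) /\
                     (forall s, s <= 0 -> F s = 0).
Proof.
move=> cf f0.
(* The base point is -1 although f vanishes on [-1, 0]: the fundamental theorem needs a point
   strictly right of the base point, and this makes s = 0 such a point. At s <= -1, [F] is locally
   0. *)
pose F x : R := \int[@lebesgue_measure R]_(t in [set` `[(-1)%R, x]]) f t.
have F0 s : s <= 0 -> F s = 0.
  move=> s0; rewrite /F (@eq_Rintegral _ _ _ _ _ (fun=> 0)).
    by rewrite Rintegral_cst ?mul0r.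
  by move=> x; rewrite inE /= in_itv /= => /andP[_ xs];
    rewrite f0// (le_trans xs).
exists F; split => // s; have [s1|s1] := ltP (-1) s; last first.
  have s0 : s < 0 by apply: le_lt_trans s1 _.
  have -> : f s = 0 by rewrite f0// ltW.
  apply: (@near_eq_is_derive _ _ _ (cst 0)).
  by near=> y; rewrite /= F0// ltW//; near: y; exact: lt_nbhsl.
have fi : (@lebesgue_measure R).-integrable `[(-1)%R, s + 1] (EFin \o f).
  apply: continuous_compact_integrable; first exact: segment_compact.
  by apply: continuous_subspaceT.
have ss : s < s + 1 by rewrite ltrDl.
have [dF <-] := continuous_FTC1_closed ss fi s1 (cf s).
by rewrite derive1E; exact: derivableP.
Unshelve. all: by end_near. Qed.

Lemma is_derive_continuous (F f : R -> R) :
  (forall s : R, is_derive s 1 F (f s)) -> continuous F.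
Proof. by move=> dF s; apply: differentiable_continuous;
  apply/derivable1_diffP. Qed.

Lemma is_derive_MVT (F f : R -> R) (a b : R) :
  (forall s : R, is_derive s 1 F (f s)) ->
  a <= b -> exists2 c, a <= c <= b & F b - F a = f c * (b - a).
Proof.
move=> dF ab; have [|c] := @MVT_segment R F f a b ab (fun x _ => dF x).
  by apply: continuous_subspaceT; exact: is_derive_continuous dF.
by rewrite in_itv; exists c.
Qed.

End antiderivative.

Section truncated_exponential.
Variables (R : realType) (c T : R).
Hypotheses (c0 : 0 < c) (T0 : 0 <= T).

Definition texp (s : R) : R := expR (c * Num.min (Num.max s 0) T).
(** With the factor c the antiderivative is exp(c s) - 1 - c s on [0, T], comparable to [texp] with
    constants free of c. Subtracting 1 gives continuity at 0 together with vanishing on the negative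
    axis, so that only the positive part of u is seen. *)
Definition ktexp (s : R) : R := c * (texp s - 1).

Let clamp_ge0 s : 0 <= Num.min (Num.max s 0) T.
Proof. by rewrite le_min le_max lexx orbT. Qed.

Lemma texp_ge1 s : 1 <= texp s.
Proof. by rewrite /texp -expR0 ler_expR mulr_ge0// ltW. Qed.

Lemma texp_le s : texp s <= expR (c * T).
Proof. by rewrite ler_expR ler_pM2l// ge_min lexx orbT. Qed.

Lemma texp_homo : {homo texp : a b / a <= b}.
Proof.
move=> a b ab; rewrite ler_expR ler_pM2l// le_min [X in _ && X]ge_min lexx orbT.
by rewrite andbT ge_min ge_max !le_max ab lexx !orbT.
Qed.

Lemma texp_npos s : s <= 0 -> texp s = 1.
Proof. by move=> s0; rewrite /texp max_r// min_l// mulr0 expR0. Qed.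

Lemma texp_continuous : continuous texp.
Proof.
move=> s; rewrite /texp;
pose g (z : R) := c * Num.min (Num.max z 0) T.
apply: (@cvg_comp _ _ _ g expR _ (nbhs (g s))); last exact: continuous_expR.
apply: (@cvgZl_tmp _ _ _ _ _ c (fun s => Num.min (Num.max s 0) T)).
have cmax : {for s, continuous (id \max (cst 0 : R -> R))}.
  by apply: continuous_max; [exact: cvg_id|exact: cvg_cst].
exact: (continuous_min cmax (cvg_cst T)).
Qed.

Lemma ktexp_ge0 s : 0 <= ktexp s.
Proof. by rewrite mulr_ge0 ?(ltW c0)// subr_ge0 texp_ge1. Qed.

Lemma ktexp_homo : {homo ktexp : a b / a <= b}.
Proof. by move=> a b ab; rewrite ler_pM2l// lerD2r texp_homo. Qed.

Lemma ktexp_npos s : s <= 0 -> ktexp s = 0.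
Proof. by move=> s0; rewrite /ktexp texp_npos// subrr mulr0. Qed.

Lemma ktexp_le s : ktexp s <= c * expR (c * T).
Proof. by rewrite ler_pM2l// lerBlDr (le_trans (texp_le s))// lerDl. Qed.

Lemma ktexp_continuous : continuous ktexp.
Proof.
move=> s; apply: (@cvgZl_tmp _ _ _ _ _ c (fun s => texp s - 1)).
by apply: (@cvgB _ _ _ _ _ texp (cst 1));
  [exact: texp_continuous|exact: cvg_cst].
Qed.

Variable K : R -> R.
Hypotheses (dK : forall s : R, is_derive s 1 K (ktexp s))
  (K0 : forall s, s <= 0 -> K s = 0).

Lemma texp_antiderivative_homo : {homo K : a b / a <= b}.
Proof.
move=> a b ab; rewrite -subr_ge0.
by have [x _ ->] := is_derive_MVT dK ab; rewrite mulr_ge0 ?subr_ge0// ktexp_ge0.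
Qed.

Lemma texp_antiderivative_ge0 s : 0 <= K s.
Proof.
have [/K0 -> //|s0] := leP s 0.
by rewrite -(K0 (lexx 0)) texp_antiderivative_homo// ltW.
Qed.

(** Beyond T the left side is constant and K increases, so it suffices to compare at y = min(s, T).
    There K(y) = exp(c y) - 1 - c y, because both sides have the same derivative on [0, y], and the
    linear term is at most half of the exponential. *)
Lemma texp_le_antiderivative s : texp s <= 2 * (1 + K s).
Proof.
have [s0|s0] := leP s 0; first by rewrite texp_npos// K0//; lra.
pose y := Num.min s T.
have y0 : 0 <= y by rewrite le_min (ltW s0).
have ey : texp s = expR (c * y) by rewrite /texp max_l// ltW.
have Ky : K y <= K s by rewrite texp_antiderivative_homo// ge_min lexx.
pose G (z : R) := K z - (expR (c * z) - c * z).
have dG (z : R) : is_derive z 1 G (ktexp z - (expR (c * z) * c - c)).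
  have d1 : is_derive z 1 (fun z : R => c * z) c.
    rewrite -[X in is_derive _ _ _ X]mulr1; exact: is_deriveZ.
  have d2 := @is_derive1_comp _ expR (fun z : R => c * z) z _ _ _ d1.
  by apply: is_deriveB.
have [z /andP[z0 zy]] := is_derive_MVT dG y0.
have -> : ktexp z = expR (c * z) * c - c.
  rewrite /ktexp /texp max_l// min_l; first by ring.
  by rewrite (le_trans zy)// ge_min lexx orbT.
rewrite subrr mul0r /G mulr0 expR0 (K0 (lexx 0)) => Gy.
(* With x = c y: exp(x) >= (1 + x/2)^2, and (1 + x/2)^2 - 2 x = (1 - x/2)^2. *)
have e2 : 2 * (c * y) <= expR (c * y).
  rewrite [X in _ <= expR X]splitr expRD; have := expR_ge1Dx (c * y / 2).
  have q0 : 0 <= c * y / 2 by rewrite divr_ge0// mulr_ge0// ltW.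
  move: (expR _) => E Eq.
  have : (1 + c * y / 2) * (1 + c * y / 2) <= E * E.
    by rewrite ler_pM// addr_ge0.
  by have := sqr_ge0 (1 - c * y / 2); rewrite expr2; lra.
by rewrite ey; lra.
Qed.

Variables (p : R) (h : R -> R).
Hypotheses (p1 : 1 < p) (dh : forall s : R, is_derive s 1 h (ktexp s `^ p))
  (h0 : forall s, s <= 0 -> h s = 0).

Lemma power_antiderivative_ge0 s : 0 <= h s.
Proof.
have [/h0 -> //|s0] := leP s 0.
have [x _] := is_derive_MVT dh (ltW s0).
by rewrite (h0 (lexx 0)) !subr0 => ->; rewrite mulr_ge0 ?powR_ge0// ltW.
Qed.

(** Since k is nondecreasing, h' = k^(p-1) K' is at most k(s)^(p-1) K' on [0, s]. The mean value
    theorem is applied to the difference, with the factor k(s)^(p-1) frozen. *)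
Lemma power_antiderivative_le s : h s <= K s * ktexp s `^ (p - 1).
Proof.
have [s0|s0] := leP s 0; first by rewrite h0// K0// mul0r.
pose G (z : R) := ktexp s `^ (p - 1) * K z - h z.
have dG (z : R) : is_derive z 1 G (ktexp s `^ (p - 1) * ktexp z - ktexp z `^ p).
  by apply: is_deriveB.
have [z /andP[_ zs]] := is_derive_MVT dG (ltW s0).
rewrite /G (K0 (lexx 0)) (h0 (lexx 0)) mulr0 !subr0 => GE.
rewrite -subr_ge0 mulrC GE mulr_ge0 ?(ltW s0)//.
rewrite -(mulr_powRB1 (ktexp_ge0 z)) ?(lt_trans _ p1)// mulrC -mulrBr.
rewrite mulr_ge0 ?ktexp_ge0// subr_ge0 ge0_ler_powR ?nnegrE ?ktexp_ge0//.
  by rewrite subr_ge0 ltW.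
exact: ktexp_homo.
Qed.

End truncated_exponential.

Lemma lipschitz_antiderivative (R : realType) (F f : R -> R) (L : R) :
  (forall s : R, is_derive s 1 F (f s)) -> (forall s, 0 <= f s <= L) ->
  forall a b, `|F a - F b| <= L * `|a - b|.
Proof.
move=> dF fL a b; wlog ab : a b / b <= a => [H|].
  by have [/H//|/ltW/H] := leP b a; rewrite distrC (distrC b).
have [x _ ->] := is_derive_MVT dF ab; have /andP[f0 fl] := fL x.
by rewrite normrM (ger0_norm f0) ler_wpM2r.
Qed.

(** * Square roots of nonnegative definite matrices *)

Section psd_sqrt.
Variable R : realType.

(** A root of a matrix A will be q(A), where q is a real polynomial interpolating the roots of the
    eigenvalues: a polynomial in A stays real and symmetric although A is diagonalised over the
    complex numbers. *)
Lemma poly_interpolation (F : fieldType) (f : F -> F) (s : seq F) :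
  exists q : {poly F}, {in s, forall x, q.[x] = f x}.
Proof.
elim: s => [|y s [q qf]]; first by exists 0.
have [ys|ys] := boolP (y \in s).
  by exists q => x; rewrite inE => /orP[/eqP->|]; exact: qf.
(* Newton's step: [w] vanishes exactly on the old nodes, so adding a multiple of it corrects the
   value at y alone. *)
pose w := \prod_(z <- s) ('X - z%:P).
have w0 x : (w.[x] == 0) = (x \in s) by rewrite -rootE root_prod_XsubC.
exists (q + ((f y - q.[y]) / w.[y])%:P * w) => x.
rewrite inE !hornerE => /predU1P[->|xs].
  by rewrite divfK ?w0// addrC subrK.
by have /eqP -> : w.[x] == 0; [rewrite w0|rewrite mulr0 addr0 qf].
Qed.

Lemma trmx_horner_mx (m : nat) (A : 'M[R]_m.+1) (q : {poly R}) :
  A^T = A -> (horner_mx A q)^T = horner_mx A q.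
Proof.
move=> AT; elim/poly_ind: q => [|q c IH]; first by rewrite rmorph0 trmx0.
rewrite rmorphD rmorphM /= horner_mx_X horner_mx_C raddfD /= trmx_mul AT IH.
by rewrite tr_scalar_mx; congr (_ + _); apply: comm_mx_horner.
Qed.

Lemma dotvC (m : nat) (x y : 'rV[R]_m) : dotv x y = dotv y x.
Proof. by apply: eq_bigr => i _; rewrite mulrC. Qed.

Lemma dotvE (m : nat) (x y : 'rV[R]_m) : (dotv x y)%:M = x *m y^T.
Proof.
apply/matrixP => i j; rewrite !ord1 !mxE mulr1n.
by apply: eq_bigr => k _; rewrite !mxE.
Qed.

Lemma dotv_mulv (m : nat) (A : 'M[R]_m) (x y : 'rV[R]_m) :
  dotv x (mulv A y) = dotv (mulv A^T x) y.
Proof.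
suff : (dotv x (mulv A y))%:M = (dotv (mulv A^T x) y)%:M :> 'M[R]_1.
  by move=> /matrixP/(_ 0 0); rewrite !mxE !mulr1n.
by rewrite !dotvE /mulv !trmx_mul !trmxK mulmxA.
Qed.

Lemma dotvv_ge0 (m : nat) (x : 'rV[R]_m) : 0 <= dotv x x.
Proof. by apply: sumr_ge0 => i _; rewrite -expr2 sqr_ge0. Qed.

Lemma dotvv_eq0 (m : nat) (x : 'rV[R]_m) : (dotv x x == 0) = (x == 0).
Proof.
apply/idP/eqP => [|->]; last by rewrite /dotv big1// => i _; rewrite mxE mul0r.
rewrite psumr_eq0; last by move=> i _; rewrite -expr2 sqr_ge0.
move=> /allP x0; apply/rowP => i; rewrite mxE; apply/eqP.
by have := x0 i (mem_index_enum _); rewrite mulf_eq0 orbb.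
Qed.

Lemma psd_eigenvalue_ge0 (m : nat) (A : 'M[R]_m) a :
  psd A -> eigenvalue A a -> 0 <= a.
Proof.
move=> [AT A0] /eigenvalueP[w wA w0].
have := A0 w; rewrite /mulv AT wA dotvC.
have -> : dotv (a *: w) w = a * dotv w w.
  by rewrite /dotv mulr_sumr; apply: eq_bigr => i _; rewrite mxE mulrA.
by rewrite pmulr_lge0// lt_neqAle dotvv_ge0 andbT eq_sym dotvv_eq0.
Qed.

Lemma horner_mx_diagonalizable (F : fieldType) (m : nat) (A P : 'M[F]_m.+1)
    (d : 'rV[F]_m.+1) (q : {poly F}) : P \in unitmx ->
  A = invmx P *m diag_mx d *m P -> (forall i, q.[d 0 i] = d 0 i) ->
  horner_mx A q = A.
Proof.
move=> Pu -> qd; rewrite horner_mx_uconjC// horner_mx_diag.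
by congr (_ *m diag_mx _ *m _); apply/rowP => i; rewrite mxE qd.
Qed.

Local Notation toC := (real_complex R).

(* The fourth root is taken so that the square root, being the square of a
   symmetric matrix, is visibly nonnegative. *)
Lemma psd_fourth_root (m : nat) (A : 'M[R]_m.+1) : psd A ->
  exists B : 'M[R]_m.+1, B^T = B /\ (B *m B) *m (B *m B) = A.
Proof.
move=> psdA; have [AT A0] := psdA; pose Ac := map_mx toC A.
have herm : Ac \is hermsymmx.
  apply: realsym_hermsym.
    apply/is_hermitianmxP; rewrite expr0 scale1r.
    by apply/matrixP => i j; rewrite !mxE -{1}AT mxE.
  apply/mxOverP => i j; rewrite mxE realE.
  by rewrite !lecE /= eqxx le_total.
have AcN := hermitian_normalmx herm.
have AcE := orthomx_spectralP AcN.
set P := spectralmx Ac in AcE; set sp := spectral_diag Ac in AcE.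
have Pu : P \in unitmx := spectral_unit Ac.
have spE i : exists2 e : R, 0 <= e & sp 0 i = toC e.
  have /mxOverP/(_ 0 i) := hermitian_spectral_diag_real herm.
  rewrite -/sp => spr.
  have [e eE] : exists e : R, sp 0 i = toC e.
    by exists (complex.Re (sp 0 i)); rewrite RRe_real.
  exists e => //; apply: psd_eigenvalue_ge0 psdA _.
  (* Being an eigenvalue is carried from the complex matrix to the real one through the
     characteristic polynomial, whose coefficients are the same. The complex eigenvector is row i of
     P, nonzero because P is invertible. *)
  rewrite eigenvalue_root_char -(fmorph_root toC) map_char_poly -/Ac.
  rewrite (_ : _ e = sp 0 i) ?eE//.
  rewrite -eigenvalue_root_char; apply/eigenvalueP.
  exists (row i P); last first.
    apply/eqP => /(congr1 (mulmx^~ (invmx P))).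
    rewrite -row_mul mulmxV// mul0mx => /rowP/(_ i)/eqP.
    by rewrite !mxE eqxx oner_eq0.
  rewrite {1}AcE -row_mul mulmxA mulKVmx//.
  by rewrite row_mul row_diag_mx -scalemxAl -rowE eE.
pose e i := complex.Re (sp 0 i).
have [q qE] := poly_interpolation (fun x : R => Num.sqrt (Num.sqrt x))
  [seq e i | i : 'I_m.+1].
have q4 i : q.[e i] * q.[e i] * (q.[e i] * q.[e i]) = e i.
  rewrite qE ?map_f ?mem_enum// -!expr2 sqr_sqrtr ?sqrtr_ge0// sqr_sqrtr//.
  by rewrite /e; have [x x0 ->] := spE i.
exists (horner_mx A q); split; first exact: trmx_horner_mx.
have -> : (horner_mx A q *m horner_mx A q) *m (horner_mx A q *m horner_mx A q)
   = horner_mx A ((q * q) * (q * q)) by rewrite !rmorphM.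
clear herm AcN; clearbody P sp.
have QE i : (map_poly toC (q * q * (q * q))).[sp 0 i] = sp 0 i.
  have spC : sp 0 i = toC (e i) by rewrite /e; have [x _ ->] := spE i.
  by rewrite spC horner_map; congr toC; rewrite !hornerM q4.
move: (q * q * (q * q)) QE => Q QE.
apply: (@map_mx_inj _ _ toC); rewrite map_horner_mx -/Ac.
exact: (horner_mx_diagonalizable Pu AcE QE).
Qed.

Lemma sqrtmxP (m : nat) (A : 'M[R]_m.+1) : psd A ->
  psd (sqrtmx A) /\ sqrtmx A *m sqrtmx A = A.
Proof.
move=> /psd_fourth_root[B [BT BA]].
rewrite /sqrtmx; case: xgetP => [S _ //|/(_ (B *m B)) []].
split=> //; split; first by rewrite trmx_mul BT.
move=> x; rewrite /mulv trmx_mul mulmxA BT.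
have := dotv_mulv B x (x *m B); rewrite /mulv !BT => ->.
exact: dotvv_ge0.
Qed.

Lemma enorm_sqrtmx (m : nat) (A : 'M[R]_m.+1) x : psd A ->
  enorm (mulv (sqrtmx A) x) = Num.sqrt (dotv x (mulv A x)).
Proof.
move=> /sqrtmxP[[ST _] SS]; rewrite /enorm.
have := dotv_mulv (sqrtmx A) x (mulv (sqrtmx A) x); rewrite ST => <-.
by rewrite {1 2}/mulv -mulmxA -trmx_mul SS.
Qed.

Lemma dotvDl (m : nat) (x y z : 'rV[R]_m) :
  dotv (x + y) z = dotv x z + dotv y z.
Proof. by rewrite -big_split; apply: eq_bigr => i _; rewrite mxE mulrDl. Qed.

Lemma dotvZl (m : nat) a (x y : 'rV[R]_m) : dotv (a *: x) y = a * dotv x y.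
Proof. by rewrite /dotv mulr_sumr; apply: eq_bigr => i _;
  rewrite mxE mulrA. Qed.

Lemma dotv_cauchy_schwarz (m : nat) (x y : 'rV[R]_m) :
  `|dotv x y| <= enorm x * enorm y.
Proof.
rewrite /enorm -sqrtrM ?dotvv_ge0// -sqrtr_sqr ler_wsqrtr//.
have [->|y0] := eqVneq y 0.
  have -> : dotv x 0 = 0 by apply: big1 => i _; rewrite mxE mulr0.
  by rewrite expr0n mulr_ge0// dotvv_ge0.
have yy : 0 < dotv y y by rewrite lt_neqAle dotvv_ge0 andbT eq_sym dotvv_eq0.
(* The squared length of |y|^2 x - (x . y) y is |y|^2 (|x|^2 |y|^2 - (x . y)^2). *)
have := dotvv_ge0 (dotv y y *: x + (- dotv x y) *: y).
rewrite dotvDl !dotvZl ![dotv _ (_ + _)]dotvC !dotvDl !dotvZl (dotvC y x).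
move=> H; rewrite -subr_ge0 -(pmulr_rge0 _ yy); apply: le_trans H _.
by rewrite le_eqVlt; apply/orP; left; apply/eqP; ring.
Qed.

Lemma enorm_ge0 (m : nat) (x : 'rV[R]_m) : 0 <= enorm x.
Proof. exact: sqrtr_ge0. Qed.

Lemma enorm_sqr (m : nat) (x : 'rV[R]_m) : enorm x ^+ 2 = dotv x x.
Proof. by rewrite sqr_sqrtr// dotvv_ge0. Qed.

Lemma ler_enormD (m : nat) (x y : 'rV[R]_m) :
  enorm (x + y) <= enorm x + enorm y.
Proof.
rewrite -ler_sqr ?nnegrE ?addr_ge0 ?enorm_ge0// sqrrD !enorm_sqr.
rewrite dotvDl ![dotv _ (_ + _)]dotvC !dotvDl (dotvC y x).
have /(le_trans (ler_norm _)) := dotv_cauchy_schwarz x y.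
by rewrite -mulr_natr; lra.
Qed.

Lemma enormZ (m : nat) a (x : 'rV[R]_m) : enorm (a *: x) = `|a| * enorm x.
Proof.
by rewrite /enorm dotvZl dotvC dotvZl mulrA -expr2 sqrtrM ?sqr_ge0// sqrtr_sqr.
Qed.

Lemma enormN (m : nat) (x : 'rV[R]_m) : enorm (- x) = enorm x.
Proof. by rewrite -[- x]scaleN1r enormZ normrN1 mul1r. Qed.

End psd_sqrt.

(** * Measurability of open sets and of partial derivatives *)

Section difference_quotient.
Variables (R : realType) (W : normedModType R) (f : W -> R) (e : W).
Hypothesis cf : continuous f.

Definition diff_quotient (h : R) (x : W) : R := h^-1 *: (f (h *: e + x) - f x).

Local Notation q := diff_quotient.

Lemma diff_quotient_continuous h : continuous (q h).
Proof.
move=> x; rewrite /diff_quotient;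
  apply: (@cvgZl_tmp _ _ _ _ _ _ (fun x => f (h *: e + x) - f x)).
apply: (@cvgB _ _ _ _ _ (fun x => f (h *: e + x))); last exact: cf.
apply: (@continuous_comp _ _ _ (fun x => h *: e + x) f); last exact: cf.
by apply: (@cvgD _ _ _ _ _ (fun=> h *: e) id); [exact: cvg_cst|exact: cvg_id].
Qed.

Lemma diff_quotient_continuous_incr x h : h != 0 ->
  {for h, continuous (q ^~ x)}.
Proof.
move=> h0; rewrite /diff_quotient; apply: (@cvgZ _ _ _ _ _ (fun h => h^-1)).
  exact: (@cvgV _ _ _ _ id).
apply: (@cvgB _ _ _ _ _ (fun h => f (h *: e + x))); last exact: cvg_cst.
apply: (@cvg_comp _ _ _ (fun h => h *: e + x) f _ (nbhs (h *: e + x)));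
  last exact: cf.
apply: (@cvgD _ _ _ _ _ (fun h => h *: e) (fun=> x)); last exact: cvg_cst.
exact: (@cvgZr_tmp _ _ _ _ _ id).
Qed.

(* Since the quotient is continuous in the increment, its oscillation near 0
   can be computed along rational increments. *)
Definition derivable_rat : set W :=
  \bigcap_(k in [set: nat]) \bigcup_(m in [set: nat])
  \bigcap_(r in [set: rat * rat])
  (if (ratr r.1 != 0 :> R) && (ratr r.2 != 0 :> R) &&
      (`|ratr r.1| < m.+1%:R^-1 :> R) && (`|ratr r.2| < m.+1%:R^-1 :> R)
   then [set x | `|q (ratr r.1) x - q (ratr r.2) x| <= k.+1%:R^-1] else setT).

Lemma derivable_ratP x : derivable_rat x <-> derivable f x e.
Proof.
split=> [Cx|].
  apply: cauchy_cvg; apply: cauchy_exP => eps eps0.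
  have [k _ ke] : exists2 k : nat, True & k.+1%:R^-1 < eps.
    exists (Num.truncn eps^-1) => //.
    by rewrite -[ltRHS]invrK ltf_pV2 ?posrE ?invr_gt0// truncnS_gt.
  have [m _ Cm] := Cx k Logic.I.
  have m0 : 0 < m.+1%:R^-1 :> R by rewrite invr_gt0.
  have /rat_in_itvoo[r0] := m0; rewrite in_itv /= => /andP[r00 r0m].
  exists (q (ratr r0) x).
  have : \forall h \near (0:R)^', h != 0 /\ `|h| < m.+1%:R^-1.
    near=> h; split; near: h; first exact: nbhs_dnbhs_neq.
    by apply: dnbhs0_lt.
  apply: filterS => h [h0 hm]; rewrite /ball /= -/(q h x).
  apply: le_lt_trans ke; rewrite leNgt; apply/negP => qh.
  (* A violating real increment h can be moved to a nearby rational one by continuity, and a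
     rational violation contradicts membership in [derivable_rat]. *)
  have : \forall h' \near h, [/\ h' != 0, `|h'| < m.+1%:R^-1 &
      k.+1%:R^-1 < `|q (ratr r0) x - q h' x|].
    near=> h'; split; near: h'.
    - exact: open_neq.
    - apply: (cvgr_lt `|h|) => //; apply: cvg_norm; exact: cvg_id.
    - apply: (cvgr_gt `|q (ratr r0) x - q h x|) => //.
      apply: cvg_norm; apply: cvgB;
        [exact: cvg_cst|exact: diff_quotient_continuous_incr].
  move=> /nbhs_ballP[d /= d0 hd].
  have /rat_in_itvoo[r] : h - d < h + d.
    by rewrite ltrBlDr -addrA ltrDl addr_gt0.
  rewrite in_itv /= => /andP[r1 r2].
  have [r'0 r'm r'q] : [/\ ratr r != 0 :> R, `|ratr r| < m.+1%:R^-1 :> R &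
      k.+1%:R^-1 < `|q (ratr r0) x - q (ratr r) x|].
    by apply: hd; rewrite /ball /= ltr_distlC r1 r2.
  have := Cm (r0, r) Logic.I.
  rewrite /= r'0 r'm (gt_eqF r00) /= gtr0_norm// r0m /=.
  by move=> /(lt_le_trans r'q); rewrite ltxx.
move=> df k _.
have k0 : 0 < k.+1%:R^-1 / 2 :> R by rewrite divr_gt0 ?invr_gt0.
have : \forall h \near (0:R)^', `|'D_e f x - q h x| < k.+1%:R^-1 / 2.
  exact: cvgr_dist_lt df _ k0.
rewrite /dnbhs; move=> /nbhs_ballP[d /= d0 hd].
exists (Num.truncn d^-1) => // r _; case: ifP => //.
move=> /andP[/andP[/andP[r10 r20] r1] r2] /=.
have dd : (Num.truncn d^-1).+1%:R^-1 <= d.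
  by rewrite -[leRHS]invrK lef_pV2 ?posrE ?invr_gt0// ltW// truncnS_gt.
have d1 := hd (ratr r.1); have d2 := hd (ratr r.2).
rewrite -(subrKA ('D_e f x)) (le_trans (ler_normD _ _))// [leRHS]splitr.
apply: lerD; last first.
  by apply/ltW/d2 => //; rewrite /ball /= sub0r normrN (lt_le_trans r2).
rewrite distrC; apply/ltW/d1 => //.
by rewrite /ball /= sub0r normrN (lt_le_trans r1).
Unshelve. all: by end_near. Qed.

End difference_quotient.

Section lebesgue_borel.
Variables (R : realType) (n : nat).
Local Notation V := 'rV[R]_n.+1.
Local Notation lebT := (caratheodory_type (@leb_outer_measure R n)).

(** The hyperplane x_i = a cuts every box of a cover into two boxes whose volumes add up. The boxes
    are open below and closed above, which matches x_i <= a on one side and x_i > a on the other. *)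
Lemma measurable_halfspace (i : 'I_n.+1) (a : R) :
  measurable ([set x | x 0 i <= a] : set lebT).
Proof.
pose H : set V := [set x | x 0 i <= a].
apply: (@le_caratheodory_measurable R V (@leb_outer_measure R n) H) => X.
change (leb_outer (X `&` H) + leb_outer (X `&` ~` H) <= leb_outer X)%E.
rewrite {3}/leb_outer.
apply: le_ereal_inf_tmp => _ [F [F0 XF] <-].
(* The value a clamped to the i-th side of the box; if the hyperplane misses the box, one of the two
   pieces is degenerate. *)
pose cl (k : nat) := Num.min ((F k).2 0 i) (Num.max a ((F k).1 0 i)).
pose upd (x : V) (c : R) : V := \row_j if j == i then c else x 0 j.
pose F1 k := ((F k).1, upd (F k).2 (cl k)).
pose F2 k := (upd (F k).1 (cl k), (F k).2).
have cl1 k : (F k).1 0 i <= cl k by rewrite /cl le_min F0 le_max lexx orbT.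
have cl2 k : cl k <= (F k).2 0 i by rewrite /cl ge_min lexx.
have c1 : box_cover (X `&` H) F1.
  split=> [k j|x [Xx Hx]].
    by rewrite /F1 /= mxE; case: eqP => [->|].
  have [k _ Fx] := XF x Xx; exists k => // j; rewrite /F1 /= mxE.
  have /andP[x1 x2] := Fx j; rewrite x1 /=; case: eqP => [ji|//].
  by move: Hx x1 x2; rewrite ji /H /cl /= le_min le_max => -> _ ->.
have c2 : box_cover (X `&` ~` H) F2.
  split=> [k j|x [Xx Hx]].
    by rewrite /F2 /= mxE; case: eqP => [->|].
  have [k _ Fx] := XF x Xx; exists k => // j; rewrite /F2 /= mxE.
  have /andP[x1 x2] := Fx j; rewrite x2 andbT; case: eqP => [ji|//].
  move: Hx x1 x2; rewrite ji /H /cl /= => /negP; rewrite -ltNge => ax x1 _.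
  by rewrite gt_min gt_max ax x1 orbT.
have vol k : ((box_vol (F k))%:E = (box_vol (F1 k))%:E + (box_vol (F2 k))%:E)%E.
  rewrite -EFinD; congr EFin; rewrite /box_vol !(bigD1 (P := predT) i)//=.
  rewrite !mxE eqxx.
  have e1 : \prod_(j < n.+1 | j != i) ((F1 k).2 0 j - (F1 k).1 0 j) =
            \prod_(j < n.+1 | j != i) ((F k).2 0 j - (F k).1 0 j).
    by apply: eq_bigr => j /negPf ji; rewrite mxE ji.
  have e2 : \prod_(j < n.+1 | j != i) ((F2 k).2 0 j - (F2 k).1 0 j) =
            \prod_(j < n.+1 | j != i) ((F k).2 0 j - (F k).1 0 j).
    by apply: eq_bigr => j /negPf ji; rewrite mxE ji.
  by rewrite e1 e2 -mulrDl; congr (_ * _); ring.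
rewrite (eq_eseriesr (fun k _ => vol k)) nneseriesD; last 2 first.
- by move=> *; apply: box_vol_ge0 c1.
- by move=> *; apply: box_vol_ge0 c2.
by apply: leeD; apply: ereal_inf_lbound; [exists F1|exists F2].
Qed.

Lemma measurable_coord (i : 'I_n.+1) :
  measurable_fun [set: lebT] (fun x : lebT => (x : V) 0 i).
Proof.
apply: (measurability _ (RGenInftyO.measurableE R)).
move=> _ [_ [a ->] <-].
rewrite setTI (_ : _ @^-1` _ =
  \bigcup_k [set x : V | x 0 i <= a - k.+1%:R^-1]); last first.
  apply/seteqP; split => [x /=|x [k _ /=]]; rewrite in_itv /=; last first.
    by move=> xa; apply: le_lt_trans xa _; rewrite ltrBlDr ltrDl invr_gt0.
  rewrite -subr_gt0 => xa; exists (Num.truncn (a - x 0 i)^-1) => //=.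
  rewrite lerBrDr -lerBrDl -[leRHS]invrK lef_pV2 ?posrE ?invr_gt0//.
  exact/ltW/truncnS_gt.
by apply: bigcupT_measurable => k; exact: measurable_halfspace.
Qed.

(** Balls of the sup norm are boxes, so U is the union of the countably many open boxes with
    rational corners that it contains. *)
Lemma measurable_open (U : set V) : open U -> measurable (U : set lebT).
Proof.
move=> oU; pose I (ab : 'rV[rat]_n.+1 * 'rV[rat]_n.+1) : set V :=
  [set x | forall i, ratr (ab.1 0 i) < x 0 i < ratr (ab.2 0 i)].
pose A ab := if `[<I ab `<=` U>] then I ab else set0.
have -> : U = \bigcup_ab A ab.
  apply/seteqP; split => [x Ux|x [ab _]]; last first.
    by rewrite /A; case: asboolP => // + Ix; exact.
  have /nbhs_ballP[e /= e0 xeU] : nbhs x U by exact: open_nbhs_nbhs.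
  have [ab abP] : exists ab : 'rV[rat]_n.+1 * 'rV[rat]_n.+1, forall i,
      x 0 i - e < ratr (ab.1 0 i) < x 0 i /\
      x 0 i < ratr (ab.2 0 i) < x 0 i + e.
    have [a aP] :
        {a : 'I_n.+1 -> rat & forall i, x 0 i - e < ratr (a i) < x 0 i}.
      apply: (@choice _ _ (fun i q => x 0 i - e < ratr q < x 0 i)) => i.
      have /rat_in_itvoo[q] : x 0 i - e < x 0 i by rewrite ltrBlDr ltrDl.
      by rewrite in_itv /= => ?; exists q.
    have [b bP] :
        {b : 'I_n.+1 -> rat & forall i, x 0 i < ratr (b i) < x 0 i + e}.
      apply: (@choice _ _ (fun i q => x 0 i < ratr q < x 0 i + e)) => i.
      have /rat_in_itvoo[q] : x 0 i < x 0 i + e by rewrite ltrDl.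
      by rewrite in_itv /= => ?; exists q.
    by exists (\row_i a i, \row_i b i) => i; rewrite !mxE; split.
  have IU : I ab `<=` U.
    move=> y Iy; apply: xeU; split=> // i j; rewrite ord1 {i} /ball /=.
    have /andP[y1 y2] := Iy j; have [/andP[a1 _] /andP[_ b2]] := abP j.
    by rewrite ltr_distlC; apply/andP; split;
      [exact: lt_trans a1 y1|exact: lt_trans y2 b2].
  exists ab => //; rewrite /A asboolT// => i.
  by have [/andP[_ ->] /andP[-> _]] := abP i.
apply: countable_bigcupT_measurable => [|ab].
  exact: countableP.
rewrite /A; case: asboolP => // _.
have -> : I ab = \bigcap_(i in [set: 'I_n.+1]) ([set: lebT] `&`
    (fun x : V => x 0 i) @^-1` `](ratr (ab.1 0 i) : R), ratr (ab.2 0 i)[).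
  apply/seteqP; split => [x Ix i _|x Ix i]; first by split=> //=;
    rewrite in_itv/= Ix.
  by have [_ /=] := Ix i Logic.I; rewrite in_itv.
apply: fin_bigcap_measurable => // i _.
exact: measurable_coord.
Qed.

Lemma measurable_continuous (f : V -> R) : continuous f ->
  measurable_fun [set: lebT] (f : lebT -> R).
Proof.
move=> /continuousP cf; apply: (measurability _ (RGenOpens.measurableE R)).
move=> _ [_ [a [b ->] <-]]; rewrite setTI; apply: measurable_open.
by apply: cf; exact: interval_open.
Qed.

Section partial_derivative.
Variables (f : V -> R) (e : V).
Hypothesis cf : continuous f.
Local Notation q := (diff_quotient f e).
Local Notation C := (derivable_rat f e).

Let mq h : measurable_fun [set: lebT] (q h : lebT -> R).
Proof. by apply: measurable_continuous; exact: diff_quotient_continuous. Qed.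

Let mC : measurable (C : set lebT).
Proof.
apply: bigcapT_measurable => k; apply: bigcupT_measurable => m.
rewrite -[X in measurable X]setCK setC_bigcap; apply: measurableC.
apply: countable_bigcupT_measurable => [|r]; first exact: countableP.
apply: measurableC.
case: ifP => // _; rewrite -[X in measurable X]setTI.
have -> : [set x : lebT | `|q (ratr r.1) x - q (ratr r.2) x| <= k.+1%:R^-1] =
    (fun x : lebT => `|q (ratr r.1) x - q (ratr r.2) x|) @^-1` `]-oo,
      k.+1%:R^-1].
  by apply/seteqP; split => x /=; rewrite in_itv.
suff : measurable_fun setT (fun x : lebT => `|q (ratr r.1) x - q (ratr r.2) x|).
  by apply.
exact: (measurableT_comp (@normr_measurable R setT) (measurable_funB (mq _) (mq
  _))).
Qed.

Lemma measurable_partial :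
  measurable_fun [set: lebT] (fun x : lebT => 'D_e f (x : V)).
Proof.
(* The indicator makes the sequence converge everywhere: off [C] the derivative is an undefined
   limit, whose default value is 0. *)
pose F (k : nat) (x : lebT) : R := \1_(C : set lebT) x * q k.+1%:R^-1 x.
apply: (@measurable_fun_cvg _ _ _ _ F) => [k|x _].
  by apply: measurable_funM => //; exact: measurable_indic.
rewrite /F indicE; have [xC|xC] := boolP (x \in C).
  under eq_fun do rewrite mul1r.
  have df : derivable f x e by apply/derivable_ratP => //; rewrite inE in xC.
  have h0 : k.+1%:R^-1 @[k --> \oo] --> (0 : R)^'.
    move=> A A0; have := @cvg_harmonic R _ A0;
      apply: (@filterS nat \oo _) => k; apply.
    by rewrite gt_eqF// harmonic_gt0.
  exact: (@cvg_comp _ _ _ (fun k : nat => k.+1%:R^-1) (q^~ x) _ _ _ h0 df).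
under eq_fun do rewrite mul0r.
rewrite (_ : 'D_e f x = 0); first exact: cvg_cst.
rewrite /derive dvgP//; apply: contraNnot xC => df.
by rewrite inE; apply/derivable_ratP.
Qed.

End partial_derivative.

End lebesgue_borel.

(** * Locally Lipschitz functions *)

Section chain_rule.
Variables (R : realType) (W : normedModType R).

Lemma cvg_line (e x : W) : (h *: e + x) @[h --> (0:R)^'] --> x.
Proof.
rewrite -[X in _ --> X]add0r -(scale0r e).
apply: (@cvgD _ _ _ _ _ (fun h => h *: e) (fun=> x)); last exact: cvg_cst.
by apply: (@cvgZr_tmp _ _ _ _ _ id); exact: nbhs_dnbhs.
Qed.

Lemma lipschitz_near_continuous (f : W -> R) (x : W) (M : R) : 0 < M ->
  (\forall y \near x, `|f y - f x| <= M * `|y - x|) -> {for x, continuous f}.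
Proof.
move=> M0 fM; apply/cvgrPdist_le => eps eps0; near=> y.
rewrite distrC (@le_trans _ _ (M * `|y - x|))//; first by near: y.
rewrite mulrC -ler_pdivlMr// distrC; near: y.
by apply: cvgr_dist_le; [exact: cvg_id|rewrite divr_gt0].
Unshelve. all: by end_near. Qed.

Lemma lipschitz_on_comp (f : W -> R) (K : R -> R) (L : R)
    (F : set_system (W * W)) {FF : Filter F} :
  0 <= L -> (forall a b, `|K a - K b| <= L * `|a - b|) ->
  lipschitz_on f F -> lipschitz_on (K \o f) F.
Proof.
move=> L0 KL; rewrite /lipschitz_on => /pinfty_ex_gt0[M M0 fM].
near=> N; have LMN : L * M <= N by near: N; apply: nbhs_pinfty_ge;
  exact: num_real.
apply: (@filterS _ F FF _ _ _ fM) => -[y z] /=; rewrite /self_sub /= => fyz.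
apply: le_trans (KL _ _) _; apply: (@le_trans _ _ (L * (M * `|y - z|))).
  by rewrite ler_wpM2l.
by rewrite mulrA ler_wpM2r.
Unshelve. all: by end_near. Qed.

(* Where the partial derivative of f does not exist, both sides are 0, the value of
   an undefined limit. *)
Lemma derive_comp_lipschitz (f : W -> R) (e x : W) (K : R -> R) (k M : R) :
  (\forall h \near (0:R)^', `|f (h *: e + x) - f x| <= M * `|h|) ->
  is_derive (f x) 1 K k ->
  'D_e (K \o f) x = k * 'D_e f x.
Proof.
move=> fM [dK Kk]; pose a := f x.
(* The slope of K between a and y, continued by k at y = a. This is Caratheodory's form of the
   derivative; it avoids dividing by f (h e + x) - f x, which may vanish for h arbitrarily close to
   0. *)
pose s y := if y == a then k else (K y - K a) / (y - a).
have sE y : K y - K a = s y * (y - a).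
  rewrite /s; case: eqVneq => [->|ya]; first by rewrite !subrr mulr0.
  by rewrite divfK// subr_eq0.
have s_cvg : s y @[y --> a] --> k.
  apply/cvgrPdist_lt => eps eps0.
  have /(cvgr_dist_lt)/(_ _ eps0)
    : h^-1 *: (K (h *: 1 + a) - K a) @[h --> 0^'] --> k.
    by rewrite -Kk.
  move=> /nbhs_ballP[d /= d0 hd]; apply/nbhs_ballP; exists d => //= y yd.
  rewrite /s; case: eqVneq => [_|ya]; first by rewrite subrr normr0.
  have := hd (y - a); rewrite /ball /= sub0r normrN subr_eq0 distrC => /(_ yd
    ya).
  by rewrite /GRing.scale /= mulr1 subrK mulrC.
pose g h := h^-1 *: (f (h *: e + x) - f x).
pose S h := s (f (h *: e + x)).
have f_cvg : f (h *: e + x) @[h --> (0:R)^'] --> a.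
  apply/cvgrPdist_le => eps eps0; near=> h.
  rewrite distrC (@le_trans _ _ (M * `|h|))//; first by near: h.
  have M0 : 0 < `|M| + 1 by rewrite ltr_wpDl.
  apply: (@le_trans _ _ ((`|M| + 1) * `|h|)).
    by rewrite ler_wpM2r// (le_trans (ler_norm _))// lerDl.
  rewrite mulrC -ler_pdivlMr//; apply/ltW; near: h; apply: dnbhs0_lt.
  by rewrite divr_gt0.
have S_cvg : S h @[h --> (0:R)^'] --> k by exact: cvg_comp f_cvg s_cvg.
have GE : (fun h => h^-1 *: ((K \o f) (h *: e + x) - (K \o f) x)) =
  (fun h => S h * g h).
  by apply/funext => h; rewrite /= -/a sE /S /g /GRing.scale /= -/a; ring.
have DE : 'D_e (K \o f) x = lim (S h * g h @[h --> (0:R)^']).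
  by rewrite -GE.
have DfE : 'D_e f x = lim (g h @[h --> (0:R)^']) by [].
rewrite DE DfE.
(* If k = 0, the quotients of f may diverge, but they are bounded by the Lipschitz constant while
   the slopes tend to 0. *)
have [k0|k0] := eqVneq k 0.
  rewrite k0 mul0r; apply: cvg_lim => //.
  apply/cvgrPdist_le => eps eps0; near=> h.
  have h0 : h != 0 by near: h; exact: nbhs_dnbhs_neq.
  have M0 : 0 < `|M| + 1 by rewrite ltr_wpDl.
  have gM : `|g h| <= `|M| + 1.
    rewrite /g normrZ normfV mulrC ler_pdivrMr ?normr_gt0//.
    apply: (@le_trans _ _ (M * `|h|)); first by near: h.
    by rewrite ler_wpM2r// (le_trans (ler_norm _))// lerDl.
  rewrite sub0r normrN normrM.
  apply: (@le_trans _ _ (`|S h| * (`|M| + 1))); first by rewrite ler_wpM2l.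
  rewrite -ler_pdivlMr//; near: h.
  move: S_cvg; rewrite k0 => /cvgr0_norm_le; apply.
  by rewrite divr_gt0.
have [gc|gc] := pselect (cvg (g h @[h --> (0:R)^'])).
  by apply: cvg_lim => //; exact: cvgM.
(* If k is nonzero, so are the slopes near 0; dividing by them would turn convergence for the
   composite into convergence for f. Hence both limits are undefined, with value 0. *)
rewrite (dvgP gc) dvgP; first by rewrite mulr0.
apply: contra_not gc => /cvg_ex[/= L GL]; apply/cvg_ex; exists (k^-1 * L).
have H : (S h)^-1 * (S h * g h) @[h --> (0:R)^'] --> k^-1 * L.
  exact: cvgM (cvgV k0 S_cvg) GL.
apply: (@cvg_trans _ ((S h)^-1 * (S h * g h) @[h --> (0:R)^'])) => //.
apply: near_eq_cvg; near=> h.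
rewrite /= mulrA mulVf ?mul1r//; near: h.
by move/cvgrPdist_lt: S_cvg => /(_ `|k|); rewrite normr_gt0 => /(_ k0);
  apply: filterS => h; apply: contraTneq => ->; rewrite subr0 ltxx.
Unshelve. all: by end_near. Qed.

End chain_rule.

Section Lip0_theory.
Variables (R : realType) (n : nat).
Local Notation V := 'rV[R]_n.+1.
Variables (Omega : set V) (phi : V -> R).
Hypotheses (oOmega : open Omega) (Lphi : Lip0 Omega phi).

Lemma Lip0_near x : Omega x ->
  exists2 M, 0 < M & \forall y \near x, `|phi y - phi x| <= M * `|y - x|.
Proof.
move=> Ox; have [+ _ _] := Lphi.
move=> /(_ (x, x) (conj Ox Ox)).
rewrite /lipschitz_on => /pinfty_ex_gt0[M M0].
rewrite /dominated_by /= => -[[A B] /= [xA xB] AB].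
exists M => //; near=> y.
have := AB (y, x); rewrite /self_sub /=; apply.
  by split; [near: y|exact: nbhs_singleton].
by split => //=; near: y; exact: open_nbhs_nbhs.
Unshelve. all: by end_near. Qed.

Lemma Lip0_near_line x e : Omega x ->
  exists M, \forall h \near (0:R)^', `|phi (h *: e + x) - phi x| <= M * `|h|.
Proof.
move=> /Lip0_near[M M0 phiM]; exists (M * `|e|).
have : \forall h \near (0:R)^',
    `|phi (h *: e + x) - phi x| <= M * `|h *: e + x - x|.
  exact: (@cvg_line R V e x _ phiM).
apply: filterS => h.
by rewrite addrK normrZ mulrAC mulrA.
Qed.

(** The Lipschitz condition speaks of points of Omega only. Any other point lies outside the closed
    support, and phi vanishes in a neighbourhood of it. *)
Lemma Lip0_continuous : continuous phi.
Proof.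
move=> x; have [Ox|Ox] := pselect (Omega x).
  by have [M M0] := Lip0_near Ox; exact: lipschitz_near_continuous.
have [_ _ sO] := Lphi.
have : nbhs x (~` closure [set y | phi y != 0]).
  by apply: open_nbhs_nbhs; split;
    [exact/closed_openC/closed_closure|move=> /sO].
have phi0 y : (~` closure [set y | phi y != 0]) y -> phi y = 0.
  by apply: contra_notP => /eqP ?; exact: subset_closure.
move=> nx; have x0 := phi0 x (nbhs_singleton nx).
apply: (@lipschitz_near_continuous R V phi x 1 ltr01).
by apply: filterS nx => y /phi0 ->; rewrite x0 subrr normr0 mul1r.
Qed.

Lemma Lip0_comp (K : R -> R) (L : R) : K 0 = 0 ->
  (forall a b, `|K a - K b| <= L * `|a - b|) -> Lip0 Omega (K \o phi).
Proof.
move=> K0 KL; have [lip cpt sub] := Lphi.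
have L0 : 0 <= L.
  by have := KL 1 0; rewrite subr0 normr1 mulr1; exact: le_trans.
have supp : closure [set x | (K \o phi) x != 0] `<=`
    closure [set x | phi x != 0].
  by apply: closure_subset => x /=; apply: contra_neq => ->.
split; last exact: subset_trans sub.
- by move=> xy xyO; apply: lipschitz_on_comp L0 KL (lip xy xyO).
- by apply: subclosed_compact cpt supp; exact: closed_closure.
Qed.

Lemma grad_comp (K k : R -> R) x : (forall y : R, is_derive y 1 K (k y)) ->
  Omega x -> grad (K \o phi) x = k (phi x) *: grad phi x.
Proof.
move=> Kk Ox; apply/rowP => i; rewrite !mxE.
have [M phiM] := Lip0_near_line 'e_i Ox.
exact: derive_comp_lipschitz phiM (Kk _).
Qed.

End Lip0_theory.

(** * The energy estimate on a measure space *)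

Section powR_inequalities.
Variables (R : realType) (p : R).
Hypothesis p1 : 1 < p.

Let p0 : 0 < p. Proof. exact: lt_trans p1. Qed.
Let pB1 : 0 <= p - 1. Proof. by rewrite subr_ge0 ltW. Qed.

Lemma powR_homo (q x y : R) : 0 <= q -> 0 <= x -> x <= y -> x `^ q <= y `^ q.
Proof. by move=> q0 x0 xy; apply: ge0_ler_powR => //;
  rewrite nnegrE// (le_trans x0). Qed.

(** Young's inequality with non-optimal constants: according as y <= e x or not, one of the two
    terms on the right already dominates. *)
Lemma powR_young (x y e : R) : 0 <= x -> 0 <= y -> 0 < e ->
  x `^ (p - 1) * y <= e * x `^ p + e^-1 `^ (p - 1) * y `^ p.
Proof.
move=> x0 y0 e0; have [yx|/ltW xy] := leP y (e * x).
  apply: (@le_trans _ _ (e * x `^ p)).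
    rewrite -(mulr_powRB1 x0 p0) mulrA mulrC ler_wpM2r ?powR_ge0//.
  by rewrite lerDl mulr_ge0 ?powR_ge0.
apply: (@le_trans _ _ (e^-1 `^ (p - 1) * y `^ p)); last first.
  by rewrite lerDr mulr_ge0 ?powR_ge0// ltW.
rewrite -(mulr_powRB1 y0 p0) (mulrC y) mulrA -powRM ?invr_ge0 ?(ltW e0)//.
by rewrite ler_wpM2r// powR_homo// ler_pdivlMl.
Qed.

Lemma powR_add_le (x y : R) : 0 <= x -> 0 <= y ->
  (x + y) `^ p <= 2 `^ p * (x `^ p + y `^ p).
Proof.
wlog xy : x y / x <= y => [H x0 y0|x0 y0].
  by have [/H|/ltW/H] := leP x y; [exact|rewrite addrC [X in _ * X]addrC;
    exact].
apply: (@le_trans _ _ ((2 * y) `^ p)).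
  by rewrite powR_homo ?(ltW p0)// ?addr_ge0//; lra.
by rewrite powRM// ler_wpM2l ?powR_ge0// lerDr powR_ge0.
Qed.

(* For vectors A, B with lengths a, b, with [s = A . B] and d the length of A - B:
   the energy [|B|^(p-2) B . A] dominates [|A|^p] up to the error [|A - B|^p]. *)
Lemma powR_monotone (a b d s : R) : 0 <= a -> 0 <= b -> 0 <= d ->
  `|s| <= a * b -> b ^+ 2 - d * b <= s -> a <= b + d ->
  (2 `^ p)^-1 / 2 * a `^ p - 2 `^ p * d `^ p <= b `^ (p - 2) * s.
Proof.
move=> a0 b0 d0 sab bs abd.
have P1 : 1 <= 2 `^ (p - 1) :> R by rewrite -[leLHS](powRr0 2) ler_powR// ler1n.
have P2 : 2 `^ p = 2 * 2 `^ (p - 1) :> R by rewrite mulr_powRB1.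
have P0 : 0 < 2 `^ p :> R by rewrite powR_gt0.
(* From a <= b + d; half of b^p is set aside here to pay for a^p. *)
have aP : (2 `^ p)^-1 / 2 * a `^ p <= (b `^ p + d `^ p) / 2.
  rewrite mulrAC ler_pM2r ?invr_gt0// ler_pdivrMl//.
  apply: le_trans (powR_add_le b0 d0); exact: powR_homo (ltW p0) a0 abd.
have dp0 : 0 <= d `^ p by exact: powR_ge0.
have [b00|b00] := eqVneq b 0.
  have -> : s = 0 by apply/normr0_eq0/eqP;
    rewrite eq_le normr_ge0 andbT (le_trans sab)// b00 mulr0.
  rewrite mulr0; move: aP; rewrite b00 powR0 ?gt_eqF// add0r.
  by rewrite P2; nra.
have bgt : 0 < b by rewrite lt_neqAle eq_sym b00.
(* Young's inequality with weight 1/2 takes from the error term b^(p-1) d only the other half of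
   b^p. *)
have h2 : 0 < 2^-1 :> R by rewrite invr_gt0.
have y := powR_young b0 d0 h2; rewrite invrK in y.
have bp : b `^ (p - 2) * b = b `^ (p - 1).
  rewrite mulrC; have -> : p - 2 = (p - 1) - 1 by ring.
  by rewrite mulr_powRB1 ?subr_gt0.
have : b `^ (p - 2) * (b ^+ 2 - d * b) <= b `^ (p - 2) * s.
  by rewrite ler_wpM2l ?powR_ge0.
have -> : b `^ (p - 2) * (b ^+ 2 - d * b) = b * b `^ (p - 1) - b `^ (p - 1) * d.
  by rewrite -bp; ring.
rewrite mulr_powRB1//; move: aP y; rewrite P2.
have : d `^ p <= 2 `^ (p - 1) * d `^ p by rewrite ler_peMl.
by lra.
Qed.

End powR_inequalities.

Section integrable_tools.
Context d (T : measurableType d) (R : realType).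
Variable mu : {measure set T -> \bar R}.
Variables (D : set T) (mD : measurable D).
Local Notation intg f := (mu.-integrable D (EFin \o f)).
Local Notation I f := (Rintegral mu D f).

Lemma integrable_dominated (f g : T -> R) : measurable_fun D f ->
  (forall x, D x -> `|f x| <= g x) -> intg g -> intg f.
Proof.
move=> mf fg; apply: le_integrable => //; first exact/measurable_EFinP.
by move=> x Dx /=; rewrite lee_fin (le_trans (fg x Dx))// ler_norm.
Qed.

Lemma integrable_lin (a b : R) (f g : T -> R) : intg f -> intg g ->
  intg (fun x => a * f x + b * g x).
Proof.
move=> fi gi.
rewrite (_ : EFin \o _ =
  ((fun x => a%:E * (EFin \o f) x) \+ (fun x => b%:E * (EFin \o g) x))%E);
    last first.
  by apply/funext => x.
by apply: integrableD => //; exact: integrableZl.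
Qed.

Lemma Rintegral_lin (a b : R) (f g : T -> R) : intg f -> intg g ->
  I (fun x => a * f x + b * g x) = a * I f + b * I g.
Proof.
move=> fi gi.
rewrite RintegralD//; first by rewrite !RintegralZl.
  exact: (@integrableZl _ _ _ _ _ mD a (EFin \o f)).
exact: (@integrableZl _ _ _ _ _ mD b (EFin \o g)).
Qed.

End integrable_tools.

(* In the application [w] is a Lip_0 function psi approximating the first component
   of (u, du), [a], [b], [dd] are the lengths of sqrt Q applied to grad psi, to du
   and to their difference, [s] is grad psi . Q du, and [tau] is t . grad psi. *)
Section energy_estimate.
Context d (T : measurableType d) (R : realType).
Variable mu : {measure set T -> \bar R}.
Variables (D : set T) (mD : measurable D).
Local Notation intg f := (mu.-integrable D (EFin \o f)).
Local Notation I f := (Rintegral mu D f).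
Variables (p M c L0 S C t0 e : R).
Hypotheses (p1 : 1 < p) (M0 : 0 < M) (c0 : 0 < c) (L00 : 0 <= L0).
Variables (K h : R -> R).
Local Notation k := (ktexp c L0).
Hypotheses (dK : forall s : R, is_derive s 1 K (k s))
  (K0 : forall s, s <= 0 -> K s = 0)
  (dh : forall s : R, is_derive s 1 h (k s `^ p))
  (h0 : forall s, s <= 0 -> h s = 0).
Variables (v a b dd s tau w F G : T -> R).
Hypotheses (mv : measurable_fun D v) (ma : measurable_fun D a)
  (mb : measurable_fun D b) (ms : measurable_fun D s)
  (mtau : measurable_fun D tau)
  (mw : measurable_fun D w) (mF : measurable_fun D F) (mG : measurable_fun D G).
Hypotheses (v0 : forall x, D x -> 0 <= v x) (a0 : forall x, D x -> 0 <= a x)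
  (b0 : forall x, D x -> 0 <= b x) (dd0 : forall x, D x -> 0 <= dd x)
  (sab : forall x, D x -> `|s x| <= a x * b x)
  (bds : forall x, D x -> b x ^+ 2 - dd x * b x <= s x)
  (abd : forall x, D x -> a x <= b x + dd x)
  (FM : forall x, D x -> `|F x| <= M `^ (p - 1))
  (GM : forall x, D x -> `|G x| <= M `^ (p - 1)).
Hypotheses (iv : intg v) (iw : intg (fun x => `|w x| `^ p * v x))
  (ia : intg (fun x => a x `^ p)) (ib : intg (fun x => b x `^ p))
  (idd : intg (fun x => dd x `^ p)).

Let p0 : 0 < p. Proof. exact: lt_trans p1. Qed.
Let L := c * expR (c * L0).

Let k_ge0 y : 0 <= k y. Proof. exact: ktexp_ge0. Qed.
Let k_le y : k y <= L. Proof. exact: ktexp_le. Qed.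
Let kp_le y : k y `^ p <= L `^ p.
Proof. by apply: powR_homo => //; exact: ltW. Qed.
Let L_ge0 : 0 <= L. Proof. exact: le_trans (k_le 0). Qed.

Let mk : measurable_fun setT k.
Proof. apply: continuous_measurable_fun; exact: ktexp_continuous. Qed.
Let mK : measurable_fun setT K.
Proof. apply: continuous_measurable_fun; exact: is_derive_continuous dK. Qed.
Let mh : measurable_fun setT h.
Proof. apply: continuous_measurable_fun; exact: is_derive_continuous dh. Qed.
Let mpow q : measurable_fun setT (fun x : R => x `^ q).
Proof. exact: measurable_powR. Qed.

Let mcomp (phi : R -> R) (f : T -> R) : measurable_fun setT phi ->
  measurable_fun D f -> measurable_fun D (fun x => phi (f x)).
Proof. by move=> mphi mf; exact: (measurableT_comp mphi mf). Qed.

Let mkp : measurable_fun D (fun x => k (w x) `^ p).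
Proof. exact: (mcomp (mpow p) (mcomp mk mw)). Qed.

(** K vanishes at 0 and has Lipschitz constant [L]. As [L] depends on the truncation level, this
    yields finiteness only and no uniform bound. *)
Lemma energy_K_le x : D x -> K (w x) `^ p * v x <= L `^ p * (`|w x| `^ p * v x).
Proof.
move=> Dx; rewrite mulrA ler_wpM2r ?v0// -powRM//.
apply: powR_homo; rewrite ?(ltW p0)//;
  first exact: texp_antiderivative_ge0 dK K0 _.
have := lipschitz_antiderivative dK (_ : forall y, 0 <= k y <= L) (w x) 0.
rewrite (K0 (lexx 0)) !subr0 => H; apply: le_trans (ler_norm _) (H _).
by move=> y; rewrite k_ge0 k_le.
Qed.

Lemma energy_integrable_K : intg (fun x => K (w x) `^ p * v x).
Proof.
apply: (@integrable_dominated _ _ _ _ _ mD _ (fun x => L `^ p * (`|w x| `^ p *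
  v x))).
- by apply: measurable_funM => //; exact: (mcomp (mpow p) (mcomp mK mw)).
- move=> x Dx; rewrite ger0_norm ?energy_K_le// mulr_ge0 ?powR_ge0 ?v0//.
- exact: (@integrableZl _ _ _ _ _ mD (L `^ p) _ iw).
Qed.

Let lhs x := b x `^ (p - 2) * (k (w x) `^ p * s x).
Let rhs x := (F x * h (w x) + G x * (k (w x) `^ p * tau x)) * v x.
Let kap x := k (w x) `^ p * a x `^ p.
Let ktau x := k (w x) `^ p * (`|tau x| `^ p * v x).

Let mlhs : measurable_fun D lhs.
Proof.
apply: measurable_funM; first exact: (mcomp (mpow _) mb).
exact: measurable_funM.
Qed.

Let mhw : measurable_fun D (fun x => h (w x)).
Proof. exact: (mcomp mh mw). Qed.

Let mrhs : measurable_fun D rhs.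
Proof.
apply: measurable_funM => //; apply: measurable_funD.
  exact: measurable_funM.
by apply: measurable_funM => //; exact: measurable_funM.
Qed.

Let h_ge0 y : 0 <= h y.
Proof. exact: (power_antiderivative_ge0 dh h0). Qed.

Let h_le y : h y <= L `^ p * (1 + `|y| `^ p).
Proof.
have := lipschitz_antiderivative dh (_ : forall y, 0 <= k y `^ p <= L `^ p) y 0.
rewrite (h0 (lexx 0)) !subr0 => H;
  apply: le_trans (ler_norm _) (le_trans (H _) _).
  by move=> z; rewrite powR_ge0 kp_le.
rewrite ler_wpM2l ?powR_ge0//.
have := powR_young p1 ler01 (normr_ge0 y) ltr01.
by rewrite invr1 !powR1 !mul1r.
Qed.

Lemma energy_integrable_lhs : intg lhs.
Proof.
have i1 := integrable_lin mD (L `^ p) (L `^ p) ia ib.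
apply: (integrable_dominated mD mlhs _ i1) => x Dx.
rewrite /lhs normrM normrM (ger0_norm (powR_ge0 _ _)) (ger0_norm (powR_ge0 _
  _)).
rewrite mulrCA -mulrDr ler_pM ?powR_ge0 ?mulr_ge0 ?powR_ge0//.
apply: (@le_trans _ _ (b x `^ (p - 2) * (a x * b x))).
  by rewrite ler_wpM2l ?powR_ge0// sab.
have [bx0|bx0] := eqVneq (b x) 0.
  by rewrite bx0 !mulr0 addr_ge0 ?powR_ge0.
have bx : 0 < b x by rewrite lt_neqAle eq_sym bx0 b0.
rewrite [X in _ * X]mulrC mulrA.
have -> : b x `^ (p - 2) * b x = b x `^ (p - 1).
  rewrite mulrC; have -> : p - 2 = (p - 1) - 1 by ring.
  by rewrite mulr_powRB1 ?subr_gt0// ltW.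
have := powR_young p1 (b0 Dx) (a0 Dx) ltr01.
by rewrite invr1 powR1 !mul1r [X in _ <= X]addrC.
Qed.

Hypothesis itau : intg ktau.

Lemma energy_integrable_rhs : intg rhs.
Proof.
have i1 := integrable_lin mD (M `^ (p - 1) * L `^ p) (M `^ (p - 1) * L `^ p) iv
  iw.
have i2 := integrable_lin mD (M `^ (p - 1) * L `^ p) (M `^ (p - 1)) iv itau.
have i3 := integrable_lin mD 1 1 i1 i2.
apply: (integrable_dominated mD mrhs _ i3) => x Dx /=.
rewrite /rhs normrM (ger0_norm (v0 Dx)) !mul1r.
have Mp : 0 <= M `^ (p - 1) by exact: powR_ge0.
have h1 : `|F x * h (w x)| <= M `^ (p - 1) * (L `^ p * (1 + `|w x| `^ p)).
  by rewrite normrM (ger0_norm (h_ge0 _)) ler_pM// FM.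
have h2 : `|G x * (k (w x) `^ p * tau x)| <=
    M `^ (p - 1) * (L `^ p + k (w x) `^ p * `|tau x| `^ p).
  rewrite normrM ler_pM// ?GM// normrM (ger0_norm (powR_ge0 _ _)).
  apply: (@le_trans _ _ (k (w x) `^ p + k (w x) `^ p * `|tau x| `^ p)).
    rewrite -[X in _ <= X + _]mulr1 -mulrDr ler_wpM2l ?powR_ge0//.
    have := powR_young p1 ler01 (normr_ge0 (tau x)) ltr01.
    by rewrite invr1 !powR1 !mul1r.
  by rewrite lerD2r kp_le.
apply: (@le_trans _ _ ((M `^ (p - 1) * (L `^ p * (1 + `|w x| `^ p)) +
  M `^ (p - 1) * (L `^ p + k (w x) `^ p * `|tau x| `^ p)) * v x)).
  by rewrite ler_wpM2r ?v0// (le_trans (ler_normD _ _))// lerD.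
by rewrite /ktau le_eqVlt; apply/orP; left; apply/eqP; ring.
Qed.

Lemma energy_integrable_kap : intg kap.
Proof.
have i1 := @integrableZl _ _ _ _ _ mD (L `^ p) _ ia.
apply: (integrable_dominated mD _ _ i1).
  by apply: measurable_funM => //; exact: (mcomp (mpow _) ma).
move=> x Dx; rewrite ger0_norm ?mulr_ge0 ?powR_ge0//.
by rewrite ler_wpM2r ?powR_ge0// kp_le.
Qed.

Let lhs_ge x : D x ->
  (2 `^ p)^-1 / 2 * kap x + - (2 `^ p * L `^ p) * dd x `^ p <= lhs x.
Proof.
move=> Dx; rewrite /lhs [X in _ <= X]mulrCA /kap.
have H := powR_monotone p1 (a0 Dx) (b0 Dx) (dd0 Dx) (sab Dx) (bds Dx) (abd Dx).
apply: le_trans (ler_wpM2l (powR_ge0 (k (w x)) p) H).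
rewrite mulrBr mulrCA lerD2l mulNr lerN2 mulrCA -mulrA.
by rewrite ler_wpM2l ?powR_ge0// ler_wpM2r ?powR_ge0// kp_le.
Qed.

Hypotheses (e0 : 0 < e) (g1 : 2 * (c * M) <= 1).
Local Notation A := ((1 + e) * (2 * (c * M)) `^ (p - 1) * 2 `^ p).

(** Origin of [A]: put g = 2 c M <= 1. Both M^(p-1) h and (M k)^p are at most g^(p-1) (1 + K)^p, the
    latter because g^p <= g^(p-1). They enter with weights 1 and e, which gives 1 + e, and splitting
    (1 + K)^p gives 2^p. *)
Let rhs_le x : D x ->
  rhs x <= (A * v x + A * (K (w x) `^ p * v x)) + e^-1 `^ (p - 1) * ktau x.
Proof.
move=> Dx; set g := 2 * (c * M).
have g0 : 0 < g by rewrite !mulr_gt0.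
set y := w x; have Ky := texp_antiderivative_ge0 c0 L00 dK K0 y.
have Mk : M * k y <= g * (1 + K y).
  rewrite /g /ktexp -mulrA; have := texp_le_antiderivative c0 L00 dK K0 y.
  have cM : 0 < c * M by rewrite mulr_gt0.
  rewrite -(ler_pM2l cM) => H; apply: (@le_trans _ _ (c * M * texp c L0 y)).
    by rewrite mulrCA mulrA ler_pM2l// gerBl.
  by apply: le_trans H _; rewrite le_eqVlt; apply/orP; left; apply/eqP; ring.
have K1 : 0 <= 1 + K y by rewrite addr_ge0.
have Mk0 : 0 <= M * k y by rewrite mulr_ge0 ?(ltW M0).
have pB1 : 0 <= p - 1 by rewrite subr_ge0 ltW.
have P1 : M `^ (p - 1) * h y <= g `^ (p - 1) * (1 + K y) `^ p.
  apply: (@le_trans _ _ (M `^ (p - 1) * (K y * k y `^ (p - 1)))).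
    by rewrite ler_wpM2l ?powR_ge0// (power_antiderivative_le c0 L00 dK K0 p1
      dh h0).
  rewrite mulrCA -powRM ?(ltW M0)// -(mulr_powRB1 K1 p0) [X in _ <= X]mulrCA.
  rewrite ler_pM ?powR_ge0// ?lerDr//.
  by rewrite -powRM ?(ltW g0)// powR_homo.
have P2 : (M * k y) `^ p <= g `^ (p - 1) * (1 + K y) `^ p.
  apply: (@le_trans _ _ ((g * (1 + K y)) `^ p));
    first by rewrite powR_homo// ltW.
  rewrite powRM ?(ltW g0)// ler_wpM2r ?powR_ge0// -(mulr_powRB1 (ltW g0) p0).
  by rewrite ler_piMl ?powR_ge0.
have P3 := powR_add_le p1 ler01 Ky; rewrite powR1 in P3.
(* Writing q^p = q^(p-1) q lets one factor join |tau| and the others join the bound M^(p-1) of G, so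
   that Young's inequality applies to M q and q |tau|. *)
have P4 q : 0 <= q -> `|G x * (q `^ p * tau x)| <=
    e * (M * q) `^ p + e^-1 `^ (p - 1) * (q `^ p * `|tau x| `^ p).
  move=> q0; have Mq0 : 0 <= M * q by rewrite mulr_ge0// ltW.
  have qt0 : 0 <= q * `|tau x| by rewrite mulr_ge0.
  have := powR_young p1 Mq0 qt0 e0; rewrite [(q * _) `^ p]powRM//;
    apply: le_trans.
  rewrite powRM ?(ltW M0)// -(mulr_powRB1 q0 p0) !normrM.
  rewrite (ger0_norm q0) (ger0_norm (powR_ge0 _ _)).
  have qq : 0 <= q * q `^ (p - 1) * `|tau x| by rewrite !mulr_ge0 ?powR_ge0.
  apply: le_trans (ler_wpM2r qq (GM Dx)) _.
  by rewrite le_eqVlt; apply/orP; left; apply/eqP; ring.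
have P5 : F x * h y <= M `^ (p - 1) * h y.
  by rewrite ler_wpM2r// (le_trans (ler_norm _))// FM.
have gp : 0 <= g `^ (p - 1) by exact: powR_ge0.
have P6 : F x * h y + G x * (k y `^ p * tau x) <=
   A * (1 + K y `^ p) + e^-1 `^ (p - 1) * (k y `^ p * `|tau x| `^ p).
  apply: le_trans (lerD P5 (le_trans (ler_norm _) (P4 _ (k_ge0 y)))) _.
  rewrite addrA lerD2r; apply: (@le_trans _ _ ((1 + e) * (g `^ (p - 1) * (1 +
    K y) `^ p))).
    by rewrite mulrDl mul1r lerD// ler_pM2l.
  rewrite -!mulrA ler_pM2l ?addr_gt0// ler_wpM2l//.
apply: le_trans (ler_wpM2r (v0 Dx) P6) _.
by rewrite le_eqVlt; apply/orP; left; apply/eqP; rewrite /ktau -/y; ring.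
Qed.

Hypotheses (S0 : 0 <= S)
  (eC : e^-1 `^ (p - 1) * C <= (2 `^ p)^-1 / 2 / 2)
  (SA : 2 * S / ((2 `^ p)^-1 / 2) * A <= 2^-1)
  (weak : I lhs <= I rhs)
  (tauC : I ktau <= C * I kap)
  (sob : I (fun x => K (w x) `^ p * v x) <= S * I kap).

Lemma energy_estimate : I (fun x => K (w x) `^ p * v x) <=
  I v + 8 * S * 2 `^ p * 2 `^ p * L `^ p * I (fun x => dd x `^ p).
Proof.
have iK := energy_integrable_K; have ik := energy_integrable_kap.
have := sob; have := tauC; have := eC; have := SA.
set Y := I (fun x => K (w x) `^ p * v x) .
set E := I (fun x => dd x `^ p).
set X := I kap.
move=> SA' eC' tauC' sob'.
have l1 : (2 `^ p)^-1 / 2 * X + - (2 `^ p * L `^ p) * E <= I lhs.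
  rewrite -Rintegral_lin//; apply: le_Rintegral => //.
  - exact: integrable_lin.
  - exact: energy_integrable_lhs.
have l2 : I rhs <= A * I v + A * Y + e^-1 `^ (p - 1) * I ktau.
  rewrite -Rintegral_lin// -[X in X + _]mul1r.
  have i1 := integrable_lin mD A A iv iK.
  rewrite -Rintegral_lin//; apply: le_Rintegral => //.
  - exact: energy_integrable_rhs.
  - exact: integrable_lin.
  - by move=> x Dx; rewrite mul1r; exact: rhs_le.
have X0 : 0 <= X.
  by apply: Rintegral_ge0 => x Dx; rewrite mulr_ge0// powR_ge0.
have P0 : 0 < 2 `^ p :> R by rewrite powR_gt0.
set P := 2 `^ p in l1 l2 eC' SA' P0 *.
set Q := L `^ p in l1 *.
have E0 : 0 <= E by apply: Rintegral_ge0 => x Dx; exact: powR_ge0.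
(* By [eC] the term with [tau] consumes at most half of the coercive term (2^p)^-1 / 2 * X in
   [l1]. *)
have l3 : e^-1 `^ (p - 1) * I ktau <= P^-1 / 2 / 2 * X.
  apply: le_trans (ler_wpM2l (powR_ge0 _ _) tauC') _.
  by rewrite mulrA ler_wpM2r.
have V0 : 0 <= I v by apply: Rintegral_ge0.
have Y0 : 0 <= Y.
  by apply: Rintegral_ge0 => x Dx; rewrite mulr_ge0 ?powR_ge0 ?v0.
set B := A in l2 SA'.
have l4 : X <= 4 * P * (P * Q * E + B * (I v + Y)).
  have l23 := le_trans l1 (le_trans weak (le_trans l2 (lerD (lexx _) l3))).
  have : P^-1 / 2 / 2 * X <= P * Q * E + B * (I v + Y).
    have e1 : P^-1 / 2 * X = P^-1 / 2 / 2 * X + P^-1 / 2 / 2 * X.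
      by rewrite -mulrDl -splitr.
    move: l23; rewrite e1 mulrDr.
    by move: (P^-1 / 2 / 2 * X) (P * Q) => z1 z2; lra.
  have -> : P^-1 / 2 / 2 = (4 * P)^-1 by rewrite !invfM; lra.
  by rewrite ler_pdivrMl// mulr_gt0.
have SB : 4 * S * P * B <= 2^-1.
  apply: le_trans SA'; rewrite le_eqVlt; apply/orP; left; apply/eqP.
  by field; rewrite gt_eqF.
have l5 : Y <= S * (4 * P * (P * Q * E)) + (4 * S * P * B) * (I v + Y).
  apply: le_trans sob' _; apply: le_trans (ler_wpM2l S0 l4) _.
  by rewrite le_eqVlt; apply/orP; left; apply/eqP; ring.
(* The coefficient of Y is at most 1/2 and Y is a finite integral, so Y moves to the left; the
   doubling turns 4 into the 8 of the statement. *)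
have := ler_wpM2r (addr_ge0 V0 Y0) SB.
by lra.
Qed.

End energy_estimate.

(** * Degenerate Sobolev spaces *)

Section power_norms.
Variables (R : realType) (p : R).
Hypothesis p0 : 0 < p.

Lemma le_poweR (x y : \bar R) (q : R) : 0 <= q -> (0 <= x)%E -> (x <= y)%E ->
  (x `^ q <= y `^ q)%E.
Proof.
move=> q0 x0 xy; apply: gt0_ler_poweR => //; rewrite in_itv /= ?leey ?andbT//.
exact: le_trans xy.
Qed.

Lemma poweRVK (x : \bar R) : (0 <= x)%E -> ((x `^ p^-1) `^ p)%E = x.
Proof. by move=> x0; rewrite -poweRrM mulVf ?gt_eqF// poweRe1. Qed.

Lemma poweRV_le (x y : \bar R) (C : R) : 0 <= C -> (0 <= x)%E -> (0 <= y)%E ->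
  (x `^ p^-1 <= C%:E * y `^ p^-1)%E -> (x <= (C `^ p)%:E * y)%E.
Proof.
move=> C0 x0 y0 /(le_poweR (ltW p0) (poweR_ge0 _ _)).
by rewrite poweRM ?poweR_ge0 ?lee_fin// !poweRVK// poweR_EFin.
Qed.

Context d (T : measurableType d) (mu : {measure set T -> \bar R}).
Variables (D : set T) (mD : measurable D).
Local Notation intg f := (mu.-integrable D (EFin \o f)).
Local Notation I f := (Rintegral mu D f).

Lemma integral_Rintegral (f : T -> R) : intg f ->
  (\int[mu]_(x in D) (f x)%:E = (I f)%:E)%E.
Proof. by move=> fi; rewrite fineK//; exact: integrable_fin_num. Qed.

Lemma ge0_integrable (f : T -> R) : measurable_fun D f ->
  (forall x, D x -> 0 <= f x) -> (\int[mu]_(x in D) (f x)%:E < +oo)%E -> intg f.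
Proof.
move=> mf f0 fy; apply/integrableP; split; first exact/measurable_EFinP.
rewrite (eq_integral (fun x => (f x)%:E)) // => x; rewrite inE => Dx /=.
by rewrite ger0_norm ?f0.
Qed.

Lemma integrable_of_poweR (f : T -> R) : measurable_fun D f ->
  (forall x, D x -> 0 <= f x) ->
  ((\int[mu]_(x in D) (f x)%:E) `^ p^-1 < +oo)%E -> intg f.
Proof.
move=> mf f0 fy; apply: ge0_integrable => //.
by apply: lty_poweRy fy; rewrite invr_eq0 gt_eqF.
Qed.

Lemma integral_EFin_ge0 (f : T -> R) : (forall x, D x -> 0 <= f x) ->
  (0 <= \int[mu]_(x in D) (f x)%:E)%E.
Proof. by move=> f0; apply: integral_ge0 => x Dx; rewrite lee_fin f0. Qed.

Lemma poweR_le_Rintegral (f g : T -> R) (C : R) : 0 <= C ->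
  measurable_fun D f -> (forall x, D x -> 0 <= f x) ->
  (forall x, D x -> 0 <= g x) -> intg g ->
  ((\int[mu]_(x in D) (f x)%:E) `^ p^-1 <=
   C%:E * (\int[mu]_(x in D) (g x)%:E) `^ p^-1)%E ->
  intg f /\ I f <= C `^ p * I g.
Proof.
move=> C0 mf f0 g0 ig /(poweRV_le C0 (integral_EFin_ge0 f0) (integral_EFin_ge0
  g0)).
rewrite (integral_Rintegral ig) -EFinM => fg.
have fi : intg f by apply: ge0_integrable => //; apply: le_lt_trans fg (ltry _).
by split => //; rewrite -lee_fin -integral_Rintegral.
Qed.

Lemma poweR_cvg0_Rintegral (f : nat -> T -> R) :
  (forall j, measurable_fun D (f j)) ->
  (forall j x, D x -> 0 <= f j x) ->
  ((\int[mu]_(x in D) (f j x)%:E) `^ p^-1)%E @[j --> \oo] --> 0%E ->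
  forall e, 0 < e -> \forall j \near \oo, intg (f j) /\ I (f j) <= e.
Proof.
move=> mf f0 f_cvg e e0.
have d0 : 0 < e `^ p^-1 by rewrite powR_gt0.
have : \forall j \near \oo,
    ((\int[mu]_(x in D) (f j x)%:E) `^ p^-1 < (e `^ p^-1)%:E)%E.
  exact: (f_cvg _ (@nbhs_open_ereal_lt R 0 (fun=> e `^ p^-1) d0)).
apply: filterS => j fj.
have fi : intg (f j).
  by apply: integrable_of_poweR => //; [exact: f0|apply: lt_trans fj (ltry _)].
split => //; rewrite -lee_fin -(integral_Rintegral fi).
rewrite -[leLHS]poweRVK; last exact: integral_EFin_ge0 (f0 j).
have := le_poweR (ltW p0) (poweR_ge0 _ _) (ltW fj).
by move/le_trans; apply; rewrite poweR_EFin -powRrM mulVf ?gt_eqF// powRr1//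
  ltW.
Qed.

End power_norms.

(** * Measurability of the integrands *)

Section measurability.
Variables (R : realType) (n : nat).
Local Notation V := 'rV[R]_n.+1.
Local Notation lebT := (caratheodory_type (@leb_outer_measure R n)).
Variable Omega : set V.
Hypothesis oOmega : open Omega.

Lemma measurable_dotv (g1 g2 : V -> V) : measurable_vec_on Omega g1 ->
  measurable_vec_on Omega g2 ->
    measurable_on Omega (fun x => dotv (g1 x) (g2 x)).
Proof.
move=> m1 m2; apply: measurable_sum => i.
by apply: measurable_funM; [exact: m1|exact: m2].
Qed.

Lemma measurable_mulv (Q : V -> 'M[R]_n.+1) (g : V -> V) :
  measurable_mx_on Omega Q -> measurable_vec_on Omega g ->
  measurable_vec_on Omega (fun x => mulv (Q x) (g x)).
Proof.
move=> mQ mg i; rewrite /measurable_on.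
under eq_fun do rewrite mxE.
apply: measurable_sum => k.
under eq_fun do rewrite mxE.
by apply: measurable_funM; [exact: mg|exact: mQ].
Qed.

Lemma measurable_vecB (g1 g2 : V -> V) : measurable_vec_on Omega g1 ->
  measurable_vec_on Omega g2 -> measurable_vec_on Omega (fun x => g1 x - g2 x).
Proof.
move=> m1 m2 i; rewrite /measurable_on.
under eq_fun do rewrite !mxE.
by apply: measurable_funB; [exact: m1|exact: m2].
Qed.

(** [sqrtmx] is defined by choice, so its measurability in x is not at hand; but the norm equals the
    square root of g . Q g, which is built from measurable entries. *)
Lemma measurable_sqrtmx_norm (Q : V -> 'M[R]_n.+1) (g : V -> V) :
  measurable_mx_on Omega Q -> (forall x, Omega x -> psd (Q x)) ->
  measurable_vec_on Omega g ->
  measurable_on Omega (fun x => enorm (mulv (sqrtmx (Q x)) (g x))).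
Proof.
move=> mQ pQ mg.
have eq_norm : {in (Omega : set lebT),
    (fun x : lebT => Num.sqrt (dotv (g x) (mulv (Q x) (g x)))) =1
    (fun x : lebT => enorm (mulv (sqrtmx (Q x)) (g x)))}.
  by move=> x; rewrite inE => Ox; rewrite enorm_sqrtmx//; exact: pQ.
apply: (eq_measurable_fun _ eq_norm).
have msqrt : measurable_fun [set: R] (@Num.sqrt R).
  by apply: continuous_measurable_fun; exact: sqrt_continuous.
apply: (measurableT_comp msqrt).
by apply: measurable_dotv => //; exact: measurable_mulv.
Qed.

Lemma measurable_Lip0 (phi : V -> R) : Lip0 Omega phi ->
  measurable_on Omega phi.
Proof.
move=> Lphi; apply: measurable_funTS; apply: measurable_continuous.
exact: Lip0_continuous oOmega Lphi.
Qed.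

Lemma measurable_grad (phi : V -> R) : Lip0 Omega phi ->
  measurable_vec_on Omega (grad phi).
Proof.
move=> Lphi i; rewrite /measurable_on; under eq_fun do rewrite mxE.
apply: measurable_funTS; apply: measurable_partial.
exact: Lip0_continuous oOmega Lphi.
Qed.

End measurability.

(** * The energy estimate for elements of QH^{1,p}_0 *)

Section QH10_energy.
Variables (R : realType) (n : nat).
Local Notation V := 'rV[R]_n.+1.
Local Notation lebT := (caratheodory_type (@leb_outer_measure R n)).
Local Notation leb := (@leb R n).
Variables (Omega : set V) (p : R) (v : V -> R) (t : V -> V)
  (Q : V -> 'M[R]_n.+1).
Hypotheses (oOmega : open Omega) (p1 : 1 < p) (wv : weight Omega v)
  (iv : integrable_on Omega v) (mQ : measurable_mx_on Omega Q)
  (pQ : forall x, Omega x -> psd (Q x)).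
Local Notation nq x g := (enorm (mulv (sqrtmx (Q x)) g)).
Local Notation intg := (integrable_on Omega).
Local Notation I f := (Rintegral leb (Omega : set lebT) f).

Let p0 : 0 < p. Proof. exact: lt_trans p1. Qed.
Let mD : measurable (Omega : set lebT). Proof. exact: measurable_open. Qed.
Let mv : measurable_on Omega v. Proof. by case: wv. Qed.
Let v0 x : Omega x -> 0 <= v x. Proof. by case: wv => _; apply. Qed.

Lemma eq_integrable_on (f g : V -> R) : (forall x, Omega x -> f x = g x) ->
  intg f -> intg g.
Proof.
move=> fg; apply: eq_integrable => // x; rewrite inE => Ox.
by rewrite fg.
Qed.

Lemma eq_Rintegral_on (f g : V -> R) : (forall x, Omega x -> f x = g x) ->
  I f = I g.
Proof. by move=> fg; apply: eq_Rintegral => x; rewrite inE => /fg. Qed.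

Let mLp (w : V -> R) : measurable_on Omega w ->
  measurable_on Omega (fun x => `|w x| `^ p * v x).
Proof.
move=> mw; apply: (measurable_funM _ mv).
apply: (measurableT_comp (@measurable_powR R p)).
exact: (measurableT_comp (@normr_measurable R setT) mw).
Qed.

Let mQLp (g : V -> V) : measurable_vec_on Omega g ->
  measurable_on Omega (fun x => nq x (g x) `^ p).
Proof.
move=> mg; apply: (measurableT_comp (@measurable_powR R p)).
exact: measurable_sqrtmx_norm.
Qed.

Let Lp0 (w : V -> R) x : Omega x -> 0 <= `|w x| `^ p * v x.
Proof. by move=> Ox; rewrite mulr_ge0 ?powR_ge0 ?v0. Qed.

Lemma in_Lp_integrable (u : V -> R) : in_Lp Omega v p u ->
  intg (fun x => `|u x| `^ p * v x).
Proof.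
move=> [mu uy]; apply: (integrable_of_poweR p0 _ _ uy); first exact: mLp.
exact: Lp0.
Qed.

Lemma in_QLp_integrable (g : V -> V) : in_QLp Omega Q p g ->
  intg (fun x => nq x (g x) `^ p).
Proof.
move=> [mg gy]; apply: (integrable_of_poweR p0 _ _ gy); first exact: mQLp.
by move=> x _; exact: powR_ge0.
Qed.

Lemma QH10_approx (u : V -> R) (du : V -> V) (e : R) : 0 < e ->
  in_QH10 Omega v Q p u du ->
  exists psi, [/\ Lip0 Omega psi,
    intg (fun x => `|psi x - u x| `^ p * v x) /\
      I (fun x => `|psi x - u x| `^ p * v x) <= e &
    intg (fun x => nq x (grad psi x - du x) `^ p) /\
      I (fun x => nq x (grad psi x - du x) `^ p) <= e].
Proof.
move=> e0 [[mu _] [mdu _] [psi [Lpsi psiu gradu]]].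
have m1 j : measurable_on Omega (fun x => `|psi j x - u x| `^ p * v x).
  apply: (@mLp (fun x => psi j x - u x)).
  exact: (measurable_funB (measurable_Lip0 oOmega (Lpsi j)) mu).
have m2 j : measurable_on Omega (fun x => nq x (grad (psi j) x - du x) `^ p).
  apply: (@mQLp (fun x => grad (psi j) x - du x)).
  exact: (measurable_vecB (measurable_grad oOmega (Lpsi j)) mdu).
have n1 j x : Omega x -> 0 <= `|psi j x - u x| `^ p * v x.
  by move=> Ox; rewrite mulr_ge0 ?powR_ge0 ?v0.
have n2 j x : Omega x -> 0 <= nq x (grad (psi j) x - du x) `^ p.
  by move=> Ox; exact: powR_ge0.
have h1 := poweR_cvg0_Rintegral p0 mD m1 n1 psiu e0.
have h2 := poweR_cvg0_Rintegral p0 mD m2 n2 gradu e0.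
near \oo => j; exists (psi j); split; first exact: Lpsi.
- by near: j; exact: h1.
- by near: j; exact: h2.
Unshelve. all: by end_near. Qed.

(** A subunit inequality with weight k(psi)^p: it is the unweighted one for [K \o psi], whose
    gradient is k(psi) grad psi. The weight produced by testing with h must therefore be the p-th
    power of a derivative. *)
Lemma subunit_test (Ct : R) (psi : V -> R) (K k : R -> R) :
  subunit_field Omega v Q p t Ct -> Lip0 Omega psi -> Lip0 Omega (K \o psi) ->
  measurable_fun setT k -> (forall s, 0 <= k s) ->
  (forall s : R, is_derive s 1 K (k s)) ->
  intg (fun x => k (psi x) `^ p * nq x (grad psi x) `^ p) ->
  intg (fun x => k (psi x) `^ p * (`|dotv (t x) (grad psi x)| `^ p * v x)) /\
  I (fun x => k (psi x) `^ p * (`|dotv (t x) (grad psi x)| `^ p * v x)) <=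
    Ct `^ p * I (fun x => k (psi x) `^ p * nq x (grad psi x) `^ p).
Proof.
move=> [mt Ct0 sub] Lpsi LK mk k0 dK ik.
have gE x : Omega x -> grad (K \o psi) x = k (psi x) *: grad psi x.
  by move=> Ox; exact: (grad_comp oOmega Lpsi dK Ox).
have m1 : measurable_on Omega
    (fun x => k (psi x) `^ p * (`|dotv (t x) (grad psi x)| `^ p * v x)).
  apply: (measurable_funM _ (mLp (measurable_dotv mt (measurable_grad oOmega
    Lpsi)))).
  apply: (measurableT_comp (@measurable_powR R p)).
  exact: (measurableT_comp mk (measurable_Lip0 oOmega Lpsi)).
have n1 x : Omega x -> 0 <=
  k (psi x) `^ p * (`|dotv (t x) (grad psi x)| `^ p * v x).
  by move=> Ox; rewrite mulr_ge0 ?powR_ge0// mulr_ge0 ?powR_ge0 ?v0.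
have n2 x : Omega x -> 0 <= k (psi x) `^ p * nq x (grad psi x) `^ p.
  by move=> Ox; rewrite mulr_ge0 ?powR_ge0.
apply: (poweR_le_Rintegral p0 mD (ltW Ct0) m1 n1 n2 ik).
have := sub _ LK; rewrite /Lp_norm /QLp_norm /integral_on.
have e1 : (\int[leb]_(x in (Omega : set lebT))
      (`|dotv (t x) (grad (K \o psi) x)| `^ p * v x)%:E =
    \int[leb]_(x in (Omega : set lebT))
      (k (psi x) `^ p * (`|dotv (t x) (grad psi x)| `^ p * v x))%:E)%E.
  apply: eq_integral => x; rewrite inE => Ox.
  rewrite gE// dotvC dotvZl dotvC normrM (ger0_norm (k0 _)).
  by rewrite powRM// mulrA.
have e2 : (\int[leb]_(x in (Omega : set lebT))
      (nq x (grad (K \o psi) x) `^ p)%:E =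
    \int[leb]_(x in (Omega : set lebT))
      (k (psi x) `^ p * nq x (grad psi x) `^ p)%:E)%E.
  apply: eq_integral => x; rewrite inE => Ox.
  rewrite gE// /mulv -scalemxAl -/(mulv _ _) enormZ (ger0_norm (k0 _)) powRM//.
  exact: enorm_ge0.
by rewrite e1 e2.
Qed.

Lemma sobolev_Lp (SN : R) (phi : V -> R) :
  sobolev Omega v Q p (N_bump p) SN -> Lip0 Omega phi ->
  intg (fun x => nq x (grad phi x) `^ p) ->
  I (fun x => `|phi x| `^ p * v x) <=
    2 `^ p * Num.max SN 1 `^ p * I (fun x => nq x (grad phi x) `^ p).
Proof.
move=> sob Lphi ig; set X := I (fun x => nq x (grad phi x) `^ p).
have mphi := measurable_Lip0 oOmega Lphi.
have X0 : 0 <= X by apply: Rintegral_ge0 => x _; exact: powR_ge0.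
(* No sign is assumed for [SN]; the maximum provides a positive constant. *)
set S := Num.max SN 1.
have S0 : 0 < S by rewrite lt_max ltr01 orbT.
have Xp0 : 0 <= X `^ p^-1 by exact: powR_ge0.
(* The Luxemburg norm is an infimum, so an admissible level l exists only above it; the slack e also
   covers the case X = 0. *)
have bound e : 0 < e -> I (fun x => `|phi x| `^ p * v x) <=
  (S * X `^ p^-1 + e) `^ p.
  move=> e0.
  have : (LPhi_norm Omega v (N_bump p) phi < (S * X `^ p^-1 + e)%:E)%E.
    apply: le_lt_trans (sob _ Lphi) _.
    rewrite /QLp_norm /integral_on (integral_Rintegral mD ig) poweR_EFin -EFinM
      lte_fin.
    by rewrite ltr_pwDr// ler_wpM2r// le_max lexx.
  move=> /ereal_inf_lt[_ [l [l0 Nl] <-]]; rewrite lte_fin => lS.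
  have lp0 : 0 < l `^ p by rewrite powR_gt0.
  have mN : measurable_on Omega (fun x => (`|phi x| / l) `^ p * v x).
    apply: (measurable_funM _ mv);
      apply: (measurableT_comp (@measurable_powR R p)).
    apply: (measurable_funM _ (measurable_cst _)).
    exact: (measurableT_comp (@normr_measurable R setT) mphi).
  have mNb : measurable_on Omega (fun x => N_bump p (`|phi x| / l) * v x).
    apply: (measurable_funM _ mv).
    have mphil : measurable_on Omega (fun x => `|phi x| / l).
      apply: (measurable_funM _ (measurable_cst _)).
      exact: (measurableT_comp (@normr_measurable R setT) mphi).
    apply: (measurable_funM (measurableT_comp (@measurable_powR R p) mphil)).
    apply: (measurableT_comp (@measurable_powR R p)).
    apply: (measurableT_comp (@measurable_ln R)).
    exact: (measurable_funD (measurable_cst _) mphil).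
  have NE x : Omega x -> (`|phi x| / l) `^ p * v x <=
    N_bump p (`|phi x| / l) * v x.
    move=> Ox; rewrite ler_wpM2r ?v0// /N_bump ler_peMr ?powR_ge0//.
    apply: (@le_trans _ _ (1 `^ p)); first by rewrite powR1.
    have s0 : 0 <= `|phi x| / l by rewrite divr_ge0// ltW.
    rewrite powR_homo ?(ltW p0)// -[X in X <= _](@expRK R 1).
    by rewrite ler_ln ?posrE ?expR_gt0 ?ltr_wpDr ?expR_gt0// lerDl.
  have l1 : (\int[leb]_(x in (Omega : set lebT))
      ((`|phi x| / l) `^ p * v x)%:E <= 1)%E.
    apply: le_trans Nl; apply: ge0_le_integral; first exact: mD.
    - by move=> x Ox; rewrite lee_fin mulr_ge0 ?powR_ge0 ?v0.
    - exact/measurable_EFinP.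
    - exact/measurable_EFinP.
    - by move=> x Ox; rewrite lee_fin NE.
  have i1 : intg (fun x => (`|phi x| / l) `^ p * v x).
    apply: (ge0_integrable mN).
      by move=> x Ox; rewrite mulr_ge0 ?powR_ge0 ?v0.
    exact: le_lt_trans l1 (ltry _).
  rewrite (integral_Rintegral mD i1) lee_fin in l1.
  apply: (@le_trans _ _ (l `^ p));
    last by rewrite powR_homo ?(ltW p0) ?(ltW l0)// ltW.
  rewrite (@eq_Rintegral_on _ (fun x => l `^ p * ((`|phi x| / l) `^ p * v x))).
    by rewrite RintegralZl// -[leRHS]mulr1 ler_pM2l.
  move=> x Ox; rewrite mulrA -powRM ?divr_ge0 ?(ltW l0)//.
  by rewrite mulrC [l * _]mulrC divfK ?gt_eqF// mulrC.
apply/ler_addgt0Pr => d d0.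
(* Chosen so that 2^p e^p = d. The factor 2^p in the constant is the price of removing the slack by
   [powR_add_le]. *)
have e0 : 0 < (d / 2 `^ p) `^ p^-1 by rewrite powR_gt0// divr_gt0// powR_gt0.
apply: le_trans (bound _ e0) _.
apply: le_trans (powR_add_le p1 _ (ltW e0)) _; first by rewrite mulr_ge0// ltW.
rewrite powRM ?(ltW S0)// -!powRrM !mulVf ?gt_eqF// !powRr1//; last first.
  by rewrite divr_ge0 ?powR_ge0// ltW.
by rewrite mulrDr mulrA [_ * (d / _)]mulrC divfK// gt_eqF// powR_gt0.
Qed.

Definition lhs_integrand (du : V -> V) (phi : V -> R) (x : V) : R :=
  nq x (du x) `^ (p - 2) * dotv (grad phi x) (mulv (Q x) (du x)).

Definition rhs_integrand (F G : V -> R) (phi : V -> R) (x : V) : R :=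
  (F x * phi x + G x * dotv (t x) (grad phi x)) * v x.

Variables (Ct SN M c L0 e : R).
Hypotheses (sub : subunit_field Omega v Q p t Ct)
  (sob : sobolev Omega v Q p (N_bump p) SN)
  (M0 : 0 < M) (c0 : 0 < c) (L00 : 0 <= L0) (e0 : 0 < e).
Variables (K h : R -> R).
Local Notation k := (ktexp c L0).
Hypotheses (dK : forall s : R, is_derive s 1 K (k s))
  (K0 : forall s, s <= 0 -> K s = 0)
  (dh : forall s : R, is_derive s 1 h (k s `^ p))
  (h0 : forall s, s <= 0 -> h s = 0).
Variables (u : V -> R) (du : V -> V) (F G : V -> R).
Hypotheses (QHu : in_QH10 Omega v Q p u du)
  (mF : measurable_on Omega F) (mG : measurable_on Omega G)
  (FM : forall x, Omega x -> `|F x| <= M `^ (p - 1))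
  (GM : forall x, Omega x -> `|G x| <= M `^ (p - 1)).
Hypothesis Hsub : forall phi, Lip0 Omega phi -> (forall x, 0 <= phi x) ->
  intg (lhs_integrand du phi) -> intg (rhs_integrand F G phi) ->
  I (lhs_integrand du phi) <= I (rhs_integrand F G phi).
Local Notation S := (2 `^ p * Num.max SN 1 `^ p).
Hypotheses (g1 : 2 * (c * M) <= 1)
  (eC : e^-1 `^ (p - 1) * Ct `^ p <= (2 `^ p)^-1 / 2 / 2)
  (SA : 2 * S / ((2 `^ p)^-1 / 2) *
    ((1 + e) * (2 * (c * M)) `^ (p - 1) * 2 `^ p) <= 2^-1).

Let L := c * expR (c * L0).
Let L_ge0 : 0 <= L. Proof. by rewrite mulr_ge0 ?expR_ge0// ltW. Qed.
Let kL s : 0 <= k s <= L. Proof. by rewrite ktexp_ge0//= ktexp_le. Qed.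
Let kpL s : 0 <= k s `^ p <= L `^ p.
Proof. by rewrite powR_ge0 powR_homo ?(ltW p0)//; case/andP: (kL s). Qed.
Let KL a b : `|K a - K b| <= L * `|a - b|.
Proof. exact: lipschitz_antiderivative dK kL a b. Qed.
Let mk : measurable_fun setT k.
Proof. by apply: continuous_measurable_fun; exact: ktexp_continuous. Qed.

Lemma Lip0_energy_estimate (psi : V -> R) : Lip0 Omega psi ->
  intg (fun x => `|psi x - u x| `^ p * v x) ->
  intg (fun x => nq x (grad psi x - du x) `^ p) ->
  intg (fun x => K (psi x) `^ p * v x) /\
  I (fun x => K (psi x) `^ p * v x) <= I v +
    8 * S * 2 `^ p * 2 `^ p * L `^ p *
    I (fun x => nq x (grad psi x - du x) `^ p).
Proof.
move=> Lpsi ipu igd; have [[mu uy] [mdu duy] _] := QHu.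
have mpsi := measurable_Lip0 oOmega Lpsi.
have mgpsi := measurable_grad oOmega Lpsi.
have iu := in_Lp_integrable (conj mu uy).
have idu := in_QLp_integrable (conj mdu duy).
have ipsi : intg (fun x => `|psi x| `^ p * v x).
  have i1 := integrable_lin mD (2 `^ p) (2 `^ p) ipu iu.
  apply: (integrable_dominated mD (mLp mpsi) _ i1) => x Ox.
  rewrite ger0_norm ?Lp0// !mulrA -mulrDl ler_wpM2r ?v0// -mulrDr.
  apply: le_trans (powR_add_le p1 (normr_ge0 _) (normr_ge0 _)).
  rewrite powR_homo ?(ltW p0)//.
  by rewrite -{1}(subrK (u x) (psi x)) ler_normD.
have nqD x g1' g2' : nq x (g1' + g2') <= nq x g1' + nq x g2'.
  by rewrite /mulv mulmxDl ler_enormD.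
have ipsig : intg (fun x => nq x (grad psi x) `^ p).
  have i1 := integrable_lin mD (2 `^ p) (2 `^ p) igd idu.
  apply: (integrable_dominated mD (mQLp mgpsi) _ i1) => x Ox.
  rewrite ger0_norm ?powR_ge0// -mulrDr.
  apply: le_trans (powR_add_le p1 (enorm_ge0 _) (enorm_ge0 _)).
  rewrite powR_homo ?(ltW p0) ?enorm_ge0//.
  by rewrite -{1}(subrK (du x) (grad psi x)) nqD.
pose a x := nq x (grad psi x); pose b x := nq x (du x).
pose dd x := nq x (grad psi x - du x).
pose s x := dotv (grad psi x) (mulv (Q x) (du x)).
pose tau x := dotv (t x) (grad psi x).
have ma : measurable_on Omega a by exact: measurable_sqrtmx_norm.
have mb : measurable_on Omega b by exact: measurable_sqrtmx_norm.
have ms : measurable_on Omega s.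
  by apply: measurable_dotv => //; exact: measurable_mulv.
have mtau : measurable_on Omega tau by case: sub => mt _ _;
  exact: measurable_dotv.
(* The pairing with Q becomes a Euclidean inner product after one symmetric root is moved to each
   factor. *)
have sE x : Omega x -> s x =
  dotv (mulv (sqrtmx (Q x)) (grad psi x)) (mulv (sqrtmx (Q x)) (du x)).
  move=> Ox; have [[ST _] SS] := sqrtmxP (pQ Ox).
  by rewrite -{1}ST -dotv_mulv /s {1 2}/mulv -mulmxA -trmx_mul SS.
have a0 x : Omega x -> 0 <= a x by move=> _; exact: enorm_ge0.
have b0 x : Omega x -> 0 <= b x by move=> _; exact: enorm_ge0.
have dd0 x : Omega x -> 0 <= dd x by move=> _; exact: enorm_ge0.
have sab x : Omega x -> `|s x| <= a x * b x.
  by move=> Ox; rewrite sE//; exact: dotv_cauchy_schwarz.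
(* With A, B the images of grad psi and du under sqrt Q: A . B = |B|^2 + (A - B) . B. *)
have bds x : Omega x -> b x ^+ 2 - dd x * b x <= s x.
  move=> Ox; rewrite sE// /b enorm_sqr lerBlDr -lerBlDl.
  set A := mulv _ (grad psi x); set B := mulv _ (du x).
  have dE : mulv (sqrtmx (Q x)) (grad psi x - du x) = A - B.
    by rewrite /mulv mulmxBl.
  rewrite /dd dE; apply: le_trans (dotv_cauchy_schwarz (A - B) B).
  rewrite -normrN; apply: le_trans (ler_norm _).
  by rewrite dotvDl -[- B]scaleN1r dotvZl; lra.
have abd x : Omega x -> a x <= b x + dd x.
  by move=> Ox; rewrite /a -{1}(subrK (du x) (grad psi x)) addrC nqD.
have LK : Lip0 Omega (K \o psi) by exact: (Lip0_comp Lpsi (K0 (lexx 0)) KL).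
have Lh : Lip0 Omega (h \o psi).
  apply: (Lip0_comp Lpsi (h0 (lexx 0))); exact: lipschitz_antiderivative dh kpL.
have ik : intg (fun x => k (psi x) `^ p * a x `^ p).
  exact: (energy_integrable_kap mD p1 c0 L00 ma mpsi ipsig).
have k0 y : 0 <= k y by case/andP: (kL y).
have [itau tauC] := subunit_test sub Lpsi LK mk k0 dK ik.
have iK : intg (fun x => K (psi x) `^ p * v x).
  exact: (energy_integrable_K mD p1 c0 L00 dK K0 mv mpsi v0 ipsi).
have K_ge0 y : 0 <= K y by exact: (texp_antiderivative_ge0 c0 L00 dK K0 y).
have gE x : Omega x -> nq x (grad (K \o psi) x) `^ p =
  k (psi x) `^ p * a x `^ p.
  move=> Ox; rewrite (grad_comp oOmega Lpsi dK Ox) /mulv -scalemxAl -/(mulv _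
    _).
  by rewrite enormZ (ger0_norm (k0 _)) powRM// enorm_ge0.
have sobK : I (fun x => K (psi x) `^ p * v x) <=
  S * I (fun x => k (psi x) `^ p * a x `^ p).
  have ig : intg (fun x => nq x (grad (K \o psi) x) `^ p).
    by apply: eq_integrable_on ik => x Ox; rewrite gE.
  have := sobolev_Lp sob LK ig; rewrite (eq_Rintegral_on gE).
  by rewrite (@eq_Rintegral_on _ (fun x => K (psi x) `^ p * v x))// => x _;
    rewrite ger0_norm /=.
have il := energy_integrable_lhs mD p1 c0 L00 mb ms mpsi a0 b0 sab ipsig idu.
have ir := energy_integrable_rhs mD p1 c0 L00 dh h0 mv mtau mpsi mF mG v0 FM GM
  iv ipsi itau.
have ghE x : Omega x -> grad (h \o psi) x = k (psi x) `^ p *: grad psi x.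
  by move=> Ox; rewrite (grad_comp oOmega Lpsi dh Ox).
have lE x : Omega x -> b x `^ (p - 2) * (k (psi x) `^ p * s x) =
    lhs_integrand du (h \o psi) x.
  by move=> Ox; rewrite /lhs_integrand ghE// dotvZl.
have rE x : Omega x ->
    (F x * h (psi x) + G x * (k (psi x) `^ p * tau x)) * v x =
    rhs_integrand F G (h \o psi) x.
  by move=> Ox; rewrite /rhs_integrand ghE// dotvC dotvZl dotvC.
have h_ge0 x : 0 <= (h \o psi) x by exact: (power_antiderivative_ge0 dh h0).
have weak := Hsub Lh h_ge0 (eq_integrable_on lE il) (eq_integrable_on rE ir).
rewrite -(eq_Rintegral_on lE) -(eq_Rintegral_on rE) in weak.
have S0 : 0 <= S by rewrite mulr_ge0 ?powR_ge0.
split=> //.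
exact: (energy_estimate mD p1 M0 c0 L00 dK K0 dh h0 mv ma mb ms mtau mpsi mF mG v0
  a0 b0 dd0 sab bds abd FM GM iv ipsi ipsig idu igd itau e0 g1 S0 eC SA weak
    tauC sobK).
Qed.

(** K is L-Lipschitz, so K(u) <= K(psi) + L |psi - u|; splitting the p-th power gives the factor
    2^p. With psi close enough to u all errors vanish, and the bound no longer depends on the
    truncation level. *)
Lemma QH10_energy_estimate : intg (fun x => K (u x) `^ p * v x) /\
  I (fun x => K (u x) `^ p * v x) <= 2 `^ p * I v.
Proof.
have [[mu uy] _ _] := QHu.
have iu := in_Lp_integrable (conj mu uy).
have K_ge0 y : 0 <= K y by exact: (texp_antiderivative_ge0 c0 L00 dK K0 y).
have iKu : intg (fun x => K (u x) `^ p * v x).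
  exact: (energy_integrable_K mD p1 c0 L00 dK K0 mv mu v0 iu).
split=> //; apply/ler_addgt0Pr => d d0.
(* The total coefficient of the approximation errors in the gradient and in the function. It depends
   on the truncation level, so psi is chosen afterwards, with both errors at most d / (2^p (C +
   1)). *)
pose C := 8 * S * 2 `^ p * 2 `^ p * L `^ p + L `^ p.
have C0 : 0 <= C by rewrite addr_ge0 ?powR_ge0// !mulr_ge0 ?powR_ge0.
have D0 : 0 < 2 `^ p * (C + 1) by rewrite mulr_gt0 ?powR_gt0// ltr_wpDl.
have [psi [Lpsi [ipu Ipu] [igd Igd]]] := QH10_approx (divr_gt0 d0 D0) QHu.
have [iK IK] := Lip0_energy_estimate Lpsi ipu igd.
have i1 := integrable_lin mD (2 `^ p) (2 `^ p * L `^ p) iK ipu.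
apply: (@le_trans _ _ (2 `^ p * I (fun x => K (psi x) `^ p * v x) +
    (2 `^ p * L `^ p) * I (fun x => `|psi x - u x| `^ p * v x))).
  rewrite -(Rintegral_lin mD _ _ iK ipu);
    apply: (le_Rintegral mD iKu i1) => x Ox.
  rewrite !mulrA -mulrDl ler_wpM2r ?v0// -mulrA -mulrDr -powRM//.
  apply: le_trans (powR_add_le p1 _ _) => //; last exact: mulr_ge0.
  rewrite powR_homo ?(ltW p0)// -lerBlDl; apply: le_trans (ler_norm _) _.
  by rewrite distrC; exact: KL.
rewrite -mulrA -mulrDr -(ler_pM2l (_ : 0 < (2 `^ p)^-1)) ?invr_gt0 ?powR_gt0//.
rewrite mulKf ?gt_eqF ?powR_gt0//.
rewrite mulrDr mulKf ?gt_eqF ?powR_gt0//.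
apply: (@le_trans _ _ (I v + C * (d / (2 `^ p * (C + 1))))).
  apply: le_trans (lerD IK (ler_wpM2l (powR_ge0 _ _) Ipu)) _.
  rewrite -addrA lerD2l; set E := d / _ in Igd *;
    rewrite /C [X in _ <= X]mulrDl lerD2r ler_wpM2l//.
  by rewrite !mulr_ge0 ?powR_ge0.
have P0 : 0 < 2 `^ p :> R by rewrite powR_gt0.
have C1 : 0 < C + 1 by rewrite ltr_wpDl.
rewrite lerD2l (_ : C * _ = (2 `^ p)^-1 * d * (C / (C + 1))).
  by rewrite ger_pMr ?mulr_gt0 ?invr_gt0// ler_pdivrMr// mul1r lerDl.
by field; rewrite !gt_eqF.
Qed.

End QH10_energy.

(** * Exponential integrability *)

Section growth_bounds.
Variable R : realType.

Lemma small_power (q a d : R) : 0 < q -> 0 <= a -> 0 < d ->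
  exists z, 0 < z <= 1 /\ z `^ q * a <= d.
Proof.
move=> q0 a0 d0; have a1 : 0 < a + 1 by rewrite ltr_wpDl.
pose y := (d / (a + 1)) `^ q^-1.
have y0 : 0 < y by rewrite powR_gt0// divr_gt0.
exists (Num.min 1 y); split; first by rewrite lt_min ltr01 y0 ge_min lexx.
apply: (@le_trans _ _ (y `^ q * a)).
  rewrite ler_wpM2r// powR_homo ?(ltW q0)//; last by rewrite ge_min lexx orbT.
  by rewrite le_min ler01 ltW.
rewrite /y -powRrM mulVf ?gt_eqF// powRr1 ?divr_ge0 ?(ltW d0) ?(ltW a1)//.
by rewrite mulrAC ler_pdivrMr// ler_wpM2l ?(ltW d0)// lerDl.
Qed.

Lemma continuous_powR (p : R) (f : R -> R) : 0 < p -> continuous f ->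
  (forall s, 0 <= f s) -> continuous (fun s => f s `^ p).
Proof.
(* At positive values the power is differentiable. At a zero of f, the bound f y ^ p <= e is read as
   f y <= e ^ (1/p). *)
move=> p0 cf f0 s; have [fs0|fs0] := eqVneq (f s) 0; last first.
  have fs : 0 < f s by rewrite lt_neqAle eq_sym fs0 f0.
  apply: (@cvg_comp _ _ _ f (fun x => x `^ p) _ (nbhs (f s))); first exact: cf.
  have dp := is_derive1_powR p fs.
  have cp : {for f s, continuous (fun x : R => x `^ p)}.
    by apply: differentiable_continuous; apply/derivable1_diffP.
  exact: cp.
apply/cvgrPdist_le => e e0; near=> y.
rewrite fs0 powR0 ?gt_eqF// sub0r normrN ger0_norm ?powR_ge0//.
have -> : e = (e `^ p^-1) `^ p by rewrite -powRrM mulVf ?gt_eqF// powRr1// ltW.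
rewrite powR_homo ?(ltW p0)//; apply/ltW; near: y.
by apply: (cvgr_lt (f s)); [exact: cf|rewrite fs0 powR_gt0].
Unshelve. all: by end_near. Qed.

(** The r-th power of z <= exp(z) at z = y / (2 r). *)
Lemma powR_le_expR (r y : R) : 0 < r -> 0 <= y ->
  y `^ r <= (2 * r) `^ r * expR (y / 2).
Proof.
move=> r0 y0; have r2 : 0 < 2 * r by rewrite mulr_gt0.
have -> : y `^ r = (2 * r) `^ r * (y / (2 * r)) `^ r.
  rewrite -powRM ?(ltW r2) ?divr_ge0 ?(ltW r2)//.
  by rewrite [X in _ = X `^ _]mulrC divfK// gt_eqF.
rewrite ler_wpM2l ?powR_ge0//.
have e1 : y / (2 * r) <= expR (y / (2 * r)).
  by apply: le_trans (expR_ge1Dx _); rewrite lerDr.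
apply: (@le_trans _ _ (expR (y / (2 * r)) `^ r)).
  by rewrite powR_homo ?(ltW r0)// divr_ge0// ltW.
rewrite -expRM [_ * r](_ : _ = y / 2)//.
by field; rewrite gt_eqF.
Qed.

(** One factor exp(y/2) pays for y^r and the other for exp(y/m), as m >= 2. The remaining factor
    m^-r can be made as small as desired. *)
Lemma H_exp_le (r m y : R) : 0 < r -> 2 <= m -> 0 <= y ->
  H_exp r (y / m) <= m^-1 `^ r * (2 * r) `^ r * expR y.
Proof.
move=> r0 m2 y0; have m0 : 0 < m by apply: lt_le_trans m2.
rewrite /H_exp powRM ?invr_ge0 ?(ltW m0)//.
have -> : expR y = expR (y / 2) * expR (y / 2) by rewrite -expRD -splitr.
have -> : y `^ r * m^-1 `^ r * expR (y / m) =
  m^-1 `^ r * (y `^ r * expR (y / m)).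
  by ring.
rewrite -!mulrA ler_wpM2l ?powR_ge0// mulrA.
apply: ler_pM; rewrite ?powR_ge0 ?expR_ge0//; first exact: powR_le_expR.
by rewrite ler_expR ler_wpM2l// lef_pV2 ?posrE.
Qed.

Lemma H_exp_ge0 (r y : R) : 0 <= H_exp r y.
Proof. by rewrite mulr_ge0 ?powR_ge0 ?expR_ge0. Qed.

Lemma measurable_H_exp (r : R) : measurable_fun setT (H_exp r).
Proof.
apply: measurable_funM; first exact: measurable_powR.
exact: measurable_expR.
Qed.

End growth_bounds.

Section exponential_integrability.
Context d (T : measurableType d) (R : realType).
Variable mu : {measure set T -> \bar R}.
Variables (D : set T) (mD : measurable D) (v u : T -> R) (p c B : R).
Hypotheses (mv : measurable_fun D v) (mu_u : measurable_fun D u)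
  (v0 : forall x, D x -> 0 <= v x) (p0 : 0 < p) (c0 : 0 < c).
Local Notation intg f := (mu.-integrable D (EFin \o f)).
Local Notation I f := (Rintegral mu D f).

Let mtexp (j : nat) : measurable_fun D (fun x => texp c j%:R (u x) `^ p * v x).
Proof.
apply: (measurable_funM _ mv); apply: (measurableT_comp (@measurable_powR R p)).
have mt : measurable_fun [set: R] (texp c j%:R).
  by apply: continuous_measurable_fun; exact: texp_continuous.
exact: (measurableT_comp mt mu_u).
Qed.

(** Monotone convergence in the truncation level; at each point the truncated exponentials are
    eventually constant. *)
Lemma exp_integral_le :
  (forall j : nat, intg (fun x => texp c j%:R (u x) `^ p * v x) /\
     I (fun x => texp c j%:R (u x) `^ p * v x) <= B) ->
  (\int[mu]_(x in D) (expR (c * Num.max (u x) 0) `^ p * v x)%:E <= B%:E)%E.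
Proof.
move=> HB.
pose g (j : nat) x : \bar R := (texp c j%:R (u x) `^ p * v x)%:E.
have mg j : measurable_fun D (g j) by exact/measurable_EFinP.
have g0 j x : D x -> (0 <= g j x)%E.
  by move=> Dx; rewrite lee_fin mulr_ge0 ?powR_ge0 ?v0.
have ndg x : D x -> {homo g^~ x : i j / (i <= j)%N >-> (i <= j)%E}.
  move=> Dx i j ij; rewrite /g lee_fin ler_wpM2r ?v0//.
  apply: powR_homo; rewrite ?(ltW p0)//; first exact: expR_ge0.
  rewrite ler_expR ler_pM2l// le_min ge_min lexx /= ge_min ler_nat ij.
  by rewrite orbT.
have gE x : D x -> limn (g^~ x) = (expR (c * Num.max (u x) 0) `^ p * v x)%:E.
  move=> Dx; apply: cvg_lim => //; apply: cvg_near_cst; near=> j.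
  rewrite /g /texp min_l//; apply/ltW.
  by near: j; exact: nbhs_infty_gtr.
rewrite (@eq_integral _ _ _ mu D (fun x => limn (g^~ x))); last first.
  by move=> x; rewrite inE => /gE ->.
rewrite (monotone_convergence mu mD mg g0 ndg).
apply: lime_le.
  apply: ereal_nondecreasing_is_cvgn => i j ij; apply: ge0_le_integral.
  - exact: mD.
  - exact: g0.
  - exact: mg.
  - exact: mg.
  - by move=> x Dx; exact: (ndg x Dx _ _ ij).
by near=> j; have [ij Ij] := HB j; rewrite /g integral_Rintegral// lee_fin.
Unshelve. all: by end_near. Qed.

(** This is [H_exp_le] at y = p c u^+, for which exp(c u^+)^p = exp(y) and the rescaled argument of
    H is y / m. *)
Lemma H_exp_integral_le (r m : R) : 0 < r -> 2 <= m ->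
  m^-1 `^ r * (2 * r) `^ r * B <= 2^-1 ->
  (\int[mu]_(x in D) (expR (c * Num.max (u x) 0) `^ p * v x)%:E <= B%:E)%E ->
  (\int[mu]_(x in D) (H_exp r (Num.max (u x) 0 / (m / (p * c))) * v x)%:E
   <= (2^-1)%:E)%E.
Proof.
move=> r0 m2 mB uB; have m0 : 0 < m by apply: lt_le_trans m2.
set A := m^-1 `^ r * (2 * r) `^ r.
have A0 : 0 <= A by rewrite mulr_ge0 ?powR_ge0.
have pc0 : 0 < p * c by rewrite mulr_gt0.
have mup : measurable_fun D (fun x => Num.max (u x) 0).
  by apply: (measurable_maxr (g := cst 0)) => //; exact: measurable_cst.
have me : measurable_fun D (fun x => expR (c * Num.max (u x) 0) `^ p * v x).
  apply: (measurable_funM _ mv);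
    apply: (measurableT_comp (@measurable_powR R p)).
  apply: (measurableT_comp (@measurable_expR R)).
  exact: (measurable_funM (measurable_cst c) mup).
have e0 x : D x -> (0 <= (expR (c * Num.max (u x) 0) `^ p * v x)%:E)%E.
  by move=> Dx; rewrite lee_fin mulr_ge0 ?powR_ge0 ?v0.
apply: (@le_trans _ _ (\int[mu]_(x in D) (A%:E * (expR (c * Num.max (u x) 0) `^
  p * v x)%:E))%E).
  apply: ge0_le_integral.
  - exact: mD.
  - by move=> x Dx; rewrite lee_fin mulr_ge0 ?H_exp_ge0 ?v0.
  - apply/measurable_EFinP; apply: (measurable_funM _ mv).
    apply: (measurableT_comp (@measurable_H_exp R r)).
    exact: (measurable_funM mup (measurable_cst _)).
  - by apply: measurable_funeM; exact/measurable_EFinP.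
  - move=> x Dx; rewrite -EFinM lee_fin mulrA ler_wpM2r ?v0//.
    set y := Num.max (u x) 0; have y0 : 0 <= y by rewrite le_max lexx orbT.
    have -> : y / (m / (p * c)) = (p * c * y) / m.
      by field; rewrite !gt_eqF.
    have -> : expR (c * y) `^ p = expR (p * c * y).
      by rewrite -expRM; congr expR; ring.
    by apply: H_exp_le => //; rewrite mulr_ge0// ltW.
rewrite ge0_integralZl//; last exact/measurable_EFinP.
apply: (@le_trans _ _ (A%:E * B%:E)%E); first by rewrite lee_wpmul2l.
by rewrite -EFinM lee_fin.
Qed.

End exponential_integrability.

(** * Sub- and supersolutions *)

Section truncated_data.
Variables (R : realType) (n : nat).
Local Notation V := 'rV[R]_n.+1.
Local Notation lebT := (caratheodory_type (@leb_outer_measure R n)).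
Local Notation leb := (@leb R n).
Variables (Omega : set V) (p : R) (v : V -> R) (t : V -> V).
Hypotheses (oOmega : open Omega) (p1 : 1 < p) (wv : weight Omega v).

Let mD : measurable (Omega : set lebT). Proof. exact: measurable_open. Qed.
Let mv : measurable_on Omega v. Proof. by case: wv. Qed.
Let v0 x : Omega x -> 0 <= v x. Proof. by case: wv => _; apply. Qed.

(* The bounds on f and g hold only v dx-almost everywhere; truncating the data makes
   them hold everywhere and changes the integrands only where v = 0, up to a null
   set. *)
Definition trunc_pow (M s : R) : R :=
  if `|s| <= M then s * `|s| `^ (p - 2) else 0.

Lemma trunc_pow_le (M s : R) : 0 <= M -> `|trunc_pow M s| <= M `^ (p - 1).
Proof.
move=> M0; rewrite /trunc_pow; case: ifP => sM; last by rewrite normr0 powR_ge0.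
rewrite normrM (ger0_norm (powR_ge0 _ _)) (_ : p - 2 = (p - 1) - 1);
  last by ring.
by rewrite mulr_powRB1 ?subr_gt0// powR_homo// subr_ge0 ltW.
Qed.

Lemma measurable_trunc_pow (M : R) : measurable_fun setT (trunc_pow M).
Proof.
have mn : measurable_fun [set: R] (@Num.norm R R) by exact: normr_measurable.
apply: measurable_fun_ifT; last exact: measurable_cst.
  by apply: measurable_fun_ler => //; exact: measurable_cst.
apply: (measurable_funM (@measurable_id _ R setT)).
exact: (measurableT_comp (@measurable_powR R (p - 2)) mn).
Qed.

Lemma Linf_norm_ge0 (f : V -> R) : (0 <= Linf_norm Omega v f)%E.
Proof. by apply: le_ereal_inf_tmp => _ [M [M0 _] <-]; rewrite lee_fin. Qed.

(** The strict inequality provides an admissible bound N < M; on the set where |f| > N the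
    nonnegative v has integral 0, hence vanishes almost everywhere. *)
Lemma Linf_norm_ae (f : V -> R) (M : R) : measurable_on Omega f ->
  (Linf_norm Omega v f < M%:E)%E ->
  {ae leb, forall x, Omega x -> M < `|f x| -> v x = 0}.
Proof.
move=> mf /ereal_inf_lt[_ [N [N0 vN] <-]]; rewrite lte_fin => NM.
pose E : set lebT := Omega `&` [set x | N < `|f x|].
have mE : measurable E.
  have mn : measurable_on Omega (fun x => `|f x|).
    exact: (measurableT_comp (@normr_measurable R setT) mf).
  have -> : E = Omega `&` (fun x => `|f x|) @^-1` `]N, +oo[.
    by apply/seteqP; split => x [Ox]; rewrite /= ?in_itv /= ?andbT; split=> //;
      rewrite /= ?in_itv /= ?andbT.
  exact: mn.
have mvE : measurable_fun E (EFin \o v).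
  by apply/measurable_EFinP; apply: measurable_funS mv => // x [].
have : (\int[leb]_(x in E) `|(EFin \o v) x|)%E = 0%E.
  rewrite -[RHS]vN; apply: eq_integral => x; rewrite inE => -[Ox _] /=.
  by rewrite ger0_norm ?v0.
move=> /(ae_eq_integral_abs leb mE mvE); apply: filterS => x Ex Ox Mfx.
by have /= [] : (EFin \o v) x = cst 0%E x by apply: Ex; split => //;
  exact: lt_trans NM Mfx.
Qed.

Lemma weak_rhs_trunc (f g phi : V -> R) (M : R) :
  measurable_vec_on Omega t -> measurable_on Omega f -> measurable_on Omega g ->
  Lip0 Omega phi ->
  (Linf_norm Omega v f < M%:E)%E -> (Linf_norm Omega v g < M%:E)%E ->
  weak_rhs Omega v p t f g phi =
  integral_on Omega (rhs_integrand v t (trunc_pow M \o f) (trunc_pow M \o g)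
    phi).
Proof.
move=> mt mf mg Lphi fM gM.
have mphi := measurable_Lip0 oOmega Lphi.
have mtau := measurable_dotv mt (measurable_grad oOmega Lphi).
have mnp (w : V -> R) : measurable_on Omega w ->
    measurable_on Omega (fun x => `|w x| `^ (p - 2)).
  move=> mw; apply: (measurableT_comp (@measurable_powR R (p - 2))).
  exact: (measurableT_comp (@normr_measurable R setT) mw).
have mT (w : V -> R) : measurable_on Omega w ->
  measurable_on Omega (trunc_pow M \o w).
  by move=> mw; exact: (measurableT_comp (@measurable_trunc_pow M) mw).
apply: ae_eq_integral; first exact: mD.
- apply/measurable_EFinP; apply: (measurable_funM _ mv); apply: measurable_funD.
    exact: (measurable_funM (measurable_funM mf (mnp _ mf)) mphi).
  exact: (measurable_funM (measurable_funM (mnp _ mg) mg) mtau).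
- apply/measurable_EFinP; apply: (measurable_funM _ mv); apply: measurable_funD.
    exact: (measurable_funM (mT _ mf) mphi).
  exact: (measurable_funM (mT _ mg) mtau).
move: (Linf_norm_ae mf fM) (Linf_norm_ae mg gM).
apply: (@filterS2 _ _ (ae_filter_ringOfSetsType leb)) => x fx gx Ox;
  rewrite /rhs_integrand /trunc_pow /=; congr EFin.
have [fMx|/(fx Ox) ->] := leP `|f x| M; last by rewrite !mulr0.
have [gMx|/(gx Ox) ->] := leP `|g x| M; last by rewrite !mulr0.
by rewrite [`|g x| `^ _ * g x]mulrC.
Qed.

End truncated_data.

Section weak_solutions.
Variables (R : realType) (n : nat).
Local Notation V := 'rV[R]_n.+1.
Local Notation lebT := (caratheodory_type (@leb_outer_measure R n)).
Local Notation leb := (@leb R n).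
Variables (Omega : set V) (p : R) (v : V -> R) (t : V -> V)
  (Q : V -> 'M[R]_n.+1).
Hypotheses (oOmega : open Omega) (p1 : 1 < p) (wv : weight Omega v)
  (iv : integrable_on Omega v) (mQ : measurable_mx_on Omega Q)
  (pQ : forall x, Omega x -> psd (Q x)).
Local Notation intg := (integrable_on Omega).
Local Notation I f := (Rintegral leb (Omega : set lebT) f).

Let p0 : 0 < p. Proof. exact: lt_trans p1. Qed.
Let mD : measurable (Omega : set lebT). Proof. exact: measurable_open. Qed.
Let mv : measurable_on Omega v. Proof. by case: wv. Qed.
Let v0 x : Omega x -> 0 <= v x. Proof. by case: wv => _; apply. Qed.

Lemma Lip0N (phi : V -> R) : Lip0 Omega phi -> Lip0 Omega (fun x => - phi x).
Proof.
move=> Lphi; apply: (@Lip0_comp _ _ _ _ Lphi (fun s => - s) 1);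
  first exact: oppr0.
by move=> a b; rewrite mul1r -opprD normrN.
Qed.

Lemma gradN (phi : V -> R) x : Lip0 Omega phi -> Omega x ->
  grad (fun x => - phi x) x = - grad phi x.
Proof.
move=> Lphi Ox; rewrite -scaleN1r.
apply: (@grad_comp _ _ _ _ oOmega Lphi (fun s => - s) (fun=> -1) x _ Ox).
Qed.

Lemma Lp_norm_congr (w1 w2 : V -> R) :
  (forall x, Omega x -> `|w1 x| = `|w2 x|) ->
  Lp_norm Omega v p w1 = Lp_norm Omega v p w2.
Proof.
move=> w12; apply: (congr1 (fun y : \bar R => y `^ p^-1)%E).
by apply: eq_integral => x; rewrite inE => Ox; rewrite w12.
Qed.

Lemma QLp_norm_congrN (g1 g2 : V -> V) : (forall x, Omega x -> g1 x = - g2 x) ->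
  QLp_norm Omega Q p g1 = QLp_norm Omega Q p g2.
Proof.
move=> g12; apply: (congr1 (fun y : \bar R => y `^ p^-1)%E).
apply: eq_integral => x; rewrite inE => Ox.
by rewrite g12// /mulv mulNmx enormN.
Qed.

Lemma in_QH10N (u : V -> R) (du : V -> V) : in_QH10 Omega v Q p u du ->
  in_QH10 Omega v Q p (fun x => - u x) (fun x => - du x).
Proof.
move=> [[mu uy] [mdu duy] [psi [Lpsi psiu gradu]]].
split.
- split; first exact: measurable_funN mu.
  by rewrite (@Lp_norm_congr _ u)// => x _; rewrite normrN.
- split; last by rewrite (@QLp_norm_congrN _ du).
  move=> i; rewrite /measurable_on; under eq_fun do rewrite mxE.
  exact: measurable_funN (mdu i).
exists (fun j x => - psi j x); split; first by move=> j; exact: Lip0N.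
  suff E : (fun j => Lp_norm Omega v p (fun x => psi j x - u x)) =
      (fun j => Lp_norm Omega v p (fun x => - psi j x - - u x)).
    exact: (eq_rect _ (fun F => F @ \oo --> 0%E) psiu _ E).
  by apply/funext => j; apply: Lp_norm_congr => x _; rewrite -opprD normrN.
suff E : (fun j => QLp_norm Omega Q p (fun x => grad (psi j) x - du x)) =
    (fun j => QLp_norm Omega Q p (fun x => grad (fun y => - psi j y) x - - du
      x)).
  exact: (eq_rect _ (fun F => F @ \oo --> 0%E) gradu _ E).
apply/funext => j; apply: QLp_norm_congrN => x Ox.
by rewrite (gradN (Lpsi j) Ox) -opprD opprK.
Qed.

(** The integrals are real numbers here, so the inequality is asked only for test functions with
    integrable integrands; this is verified for [h \o psi] before use. *)
Definition real_subsolution (F G : V -> R) (du : V -> V) : Prop :=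
  forall phi, Lip0 Omega phi -> (forall x, 0 <= phi x) ->
  intg (lhs_integrand p Q du phi) -> intg (rhs_integrand v t F G phi) ->
  I (lhs_integrand p Q du phi) <= I (rhs_integrand v t F G phi).

Lemma weak_subsolution_real (f g u : V -> R) (du : V -> V) (M : R) :
  measurable_vec_on Omega t -> measurable_on Omega f -> measurable_on Omega g ->
  (Linf_norm Omega v f < M%:E)%E -> (Linf_norm Omega v g < M%:E)%E ->
  weak_subsolution Omega v Q p t f g u du ->
  real_subsolution (trunc_pow p M \o f) (trunc_pow p M \o g) du.
Proof.
move=> mt mf mg fM gM [_ sub] phi Lphi phi0 il ir.
have := sub phi Lphi phi0;
  rewrite (weak_rhs_trunc p oOmega wv mt mf mg Lphi fM gM).
rewrite /weak_lhs /integral_on (integral_Rintegral mD il) (integral_Rintegral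
  mD ir).
by rewrite lee_fin.
Qed.

Lemma weak_supersolution_real (f g u : V -> R) (du : V -> V) (M : R) :
  measurable_vec_on Omega t -> measurable_on Omega f -> measurable_on Omega g ->
  (Linf_norm Omega v f < M%:E)%E -> (Linf_norm Omega v g < M%:E)%E ->
  weak_supersolution Omega v Q p t f g u du ->
  real_subsolution (fun x => - trunc_pow p M (f x))
    (fun x => - trunc_pow p M (g x)) (fun x => - du x).
Proof.
move=> mt mf mg fM gM [_ sup] phi Lphi phi0 il ir.
have lE x : -1 * lhs_integrand p Q (fun x => - du x) phi x =
  lhs_integrand p Q du phi x.
  rewrite /lhs_integrand /mulv !mulNmx enormN -[- (du x *m _)]scaleN1r.
  by rewrite [dotv _ (-1 *: _)]dotvC dotvZl [dotv _ (grad _ _)]dotvC; ring.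
have rE x : -1 * rhs_integrand v t (fun x => - trunc_pow p M (f x))
      (fun x => - trunc_pow p M (g x)) phi x =
    rhs_integrand v t (trunc_pow p M \o f) (trunc_pow p M \o g) phi x.
  by rewrite /rhs_integrand /=; ring.
have il' := eq_integrable_on oOmega (fun x _ => lE x) (@integrableZl _ _ _ _ _
  mD (-1) _ il).
have ir' := eq_integrable_on oOmega (fun x _ => rE x) (@integrableZl _ _ _ _ _
  mD (-1) _ ir).
have := sup phi Lphi phi0;
  rewrite (weak_rhs_trunc p oOmega wv mt mf mg Lphi fM gM).
rewrite /weak_lhs /integral_on (integral_Rintegral mD il') (integral_Rintegral
  mD ir').
rewrite lee_fin -(eq_Rintegral_on (fun x _ => lE x)) -(eq_Rintegral_on (fun x _
  => rE x)).
by rewrite !RintegralZl// !mulN1r lerN2.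
Qed.

Variables (r SN Ct M g e m : R).
Local Notation S := (2 `^ p * Num.max SN 1 `^ p).
Local Notation B := (2 `^ p * 2 `^ p * (1 + 2 `^ p) * I v).
Hypotheses (r0 : 0 < r) (sub : subunit_field Omega v Q p t Ct)
  (sob : sobolev Omega v Q p (N_bump p) SN) (M0 : 0 < M) (g0 : 0 < g)
  (g1 : g <= 1)
  (e0 : 0 < e) (m2 : 2 <= m)
  (eC : e^-1 `^ (p - 1) * Ct `^ p <= (2 `^ p)^-1 / 2 / 2)
  (SA : 2 * S / ((2 `^ p)^-1 / 2) * ((1 + e) * g `^ (p - 1) * 2 `^ p) <= 2^-1)
  (mB : m^-1 `^ r * (2 * r) `^ r * B <= 2^-1).

Lemma real_subsolution_exp (F G u : V -> R) (du : V -> V) :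
  in_QH10 Omega v Q p u du -> measurable_on Omega F -> measurable_on Omega G ->
  (forall x, `|F x| <= M `^ (p - 1)) -> (forall x, `|G x| <= M `^ (p - 1)) ->
  real_subsolution F G du ->
  (integral_on Omega (fun x =>
     H_exp r (Num.max (u x) 0 / (m / (p * (g / 2)) * M)) * v x)%R <=
       (2^-1)%:E)%E.
Proof.
move=> QHu mF mG FM GM Hsub; have [[mu uy] _ _] := QHu.
pose c := g / 2 / M.
have c0 : 0 < c by rewrite !divr_gt0.
have cM : 2 * (c * M) = g by rewrite /c; field; rewrite gt_eqF.
rewrite (_ : m / (p * (g / 2)) * M = m / (p * c)); last first.
  by rewrite /c; field; rewrite !gt_eqF.
apply: (H_exp_integral_le mD mv mu v0 p0 c0 r0 m2 mB).
apply: (exp_integral_le mD mv mu v0 p0 c0) => j.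
have [h [dh h0]] : exists h : R -> R,
    (forall s : R, is_derive s 1 h (ktexp c j%:R s `^ p)) /\
    (forall s, s <= 0 -> h s = 0).
  apply: antiderivative; last first.
    by move=> s s0; rewrite ktexp_npos// powR0// gt_eqF.
  apply: continuous_powR => // s; first exact: ktexp_continuous.
  exact: (ktexp_ge0 c0 (ler0n _ j)).
have [K [dK K0]] := antiderivative (@ktexp_continuous R c j%:R) (@ktexp_npos R
  c j%:R (ler0n _ _)).
have g1' : 2 * (c * M) <= 1 by rewrite cM.
have SA' : 2 * S / ((2 `^ p)^-1 / 2) *
    ((1 + e) * (2 * (c * M)) `^ (p - 1) * 2 `^ p) <= 2^-1 by rewrite cM.
have [iK IK] := QH10_energy_estimate oOmega p1 wv iv mQ pQ sub sob M0 c0 (ler0n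
  _ j) e0
  dK K0 dh h0 QHu mF mG (fun x _ => FM x) (fun x _ => GM x) Hsub g1' eC SA'.
(* Origin of [B]: texp^p <= 2^p (1 + K)^p <= 2^p 2^p (1 + K^p). Integration turns 1 into v(Omega)
   and K^p into at most 2^p v(Omega). *)
have i1 := integrable_lin mD (2 `^ p * 2 `^ p) (2 `^ p * 2 `^ p) iv iK.
have K_ge0 y : 0 <= K y by exact: (texp_antiderivative_ge0 c0 (ler0n _ j) dK K0
  y).
have le1 x : Omega x -> texp c j%:R (u x) `^ p * v x <=
    2 `^ p * 2 `^ p * v x + 2 `^ p * 2 `^ p * (K (u x) `^ p * v x).
  move=> Ox; rewrite [in leRHS]mulrA -mulrDl ler_wpM2r ?v0// -[in leRHS]mulrA.
  rewrite -[X in X + _]mulr1 -!mulrA -!mulrDr.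
  have := texp_le_antiderivative c0 (ler0n _ j) dK K0 (u x).
  move=> /(powR_homo (ltW p0) (expR_ge0 _)) /le_trans; apply.
  rewrite powRM ?addr_ge0// ler_wpM2l ?powR_ge0//.
  by have := powR_add_le p1 ler01 (K_ge0 (u x)); rewrite powR1.
have mtx : measurable_on Omega (fun x => texp c j%:R (u x) `^ p * v x).
  apply: (measurable_funM _ mv);
    apply: (measurableT_comp (@measurable_powR R p)).
  have mt : measurable_fun [set: R] (texp c j%:R).
    by apply: continuous_measurable_fun; exact: texp_continuous.
  exact: (measurableT_comp mt mu).
have it : intg (fun x => texp c j%:R (u x) `^ p * v x).
  apply: (integrable_dominated mD mtx _ i1) => x Ox.
  by rewrite ger0_norm ?le1// mulr_ge0 ?powR_ge0 ?v0.
split => //; apply: le_trans (le_Rintegral mD it i1 le1) _.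
rewrite (Rintegral_lin mD _ _ iv iK) -mulrDr -[leRHS]mulrA ler_wpM2l ?mulr_ge0
  ?powR_ge0//.
by rewrite mulrDl mul1r lerD2l.
Qed.

End weak_solutions.

(** * Luxemburg norms and the choice of constants *)

Lemma LPhi_norm_le (R : realType) (n : nat) (Omega : set 'rV[R]_n.+1)
    (v f g h : 'rV[R]_n.+1 -> R) (Phi : R -> R) (C : R) :
  0 < C -> in_Linf Omega v f -> in_Linf Omega v g ->
  (forall M : R, 0 < M -> (Linf_norm Omega v f < M%:E)%E ->
     (Linf_norm Omega v g < M%:E)%E ->
     (integral_on Omega (fun x => Phi (`|h x| / (C * M)) * v x)%R <= 1)%E) ->
  (LPhi_norm Omega v Phi h <=
    C%:E * (Linf_norm Omega v f + Linf_norm Omega v g))%E.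
Proof.
move=> C0 [_ fy] [_ gy] H.
have f0 := Linf_norm_ge0 Omega v f; have g0 := Linf_norm_ge0 Omega v g.
move: (Linf_norm Omega v f) (Linf_norm Omega v g) f0 g0 fy gy H => [a| |] [b|
  |] //.
rewrite !lee_fin => a0 b0 _ _ H.
apply/lee_addgt0Pr => e e0; rewrite -EFinD.
have eC : 0 < e / C by rewrite divr_gt0.
(* This M is positive and strictly above both norms even if they are 0; the surplus e / C adds just
   e to C M. *)
have M0 : 0 < a + b + e / C by rewrite ltr_wpDl ?addr_ge0.
apply: ereal_inf_lbound; exists (C * (a + b + e / C)); last first.
  by congr EFin; field; rewrite gt_eqF.
split; first by rewrite mulr_gt0.
by apply: H => //; rewrite lte_fin; lra.
Qed.

Theorem corollary1p10 (R : realType) (n : nat) (Omega : set 'rV[R]_n.+1)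
    (p r SN Ct : R) (v : 'rV[R]_n.+1 -> R) (t : 'rV[R]_n.+1 -> 'rV[R]_n.+1)
    (domain_Omega : domain Omega) (bounded_Omega : bounded_set Omega)
    (p_gt1 : 1 < p) (r_gt0 : 0 < r)
    (weight_v : weight Omega v) (integrable_v : integrable_on Omega v) :
  exists C : R, 0 < C /\
  forall (Q : 'rV[R]_n.+1 -> 'M[R]_n.+1) (k : R),
    measurable_mx_on Omega Q ->
    (forall x, Omega x -> psd (Q x)) ->
    {ae @leb R n, forall x, Omega x -> opnorm (Q x) `^ (p / 2) <= k * v x} ->
    subunit_field Omega v Q p t Ct ->
    sobolev Omega v Q p (N_bump p) SN ->
  forall f g : 'rV[R]_n.+1 -> R, in_Linf Omega v f -> in_Linf Omega v g ->
  forall (u : 'rV[R]_n.+1 -> R) (du : 'rV[R]_n.+1 -> 'rV[R]_n.+1),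
    [/\ weak_subsolution Omega v Q p t f g u du ->
          (LPhi_norm Omega v (H_exp r) (fun x => Num.max (u x) 0)%R <=
           C%:E * (Linf_norm Omega v f + Linf_norm Omega v g))%E,
        weak_supersolution Omega v Q p t f g u du ->
          (LPhi_norm Omega v (H_exp r) (fun x => Num.max (- u x) 0)%R <=
           C%:E * (Linf_norm Omega v f + Linf_norm Omega v g))%E &
        weak_solution Omega v Q p t f g u du ->
          in_LPhi Omega v (H_exp r) u /\
          (LPhi_norm Omega v (H_exp r) u <=
           C%:E * (Linf_norm Omega v f + Linf_norm Omega v g))%E].
Proof.
have [oO _ _] := domain_Omega.
have p0 : 0 < p by apply: lt_trans p_gt1.
have q0 : 0 < p - 1 by rewrite subr_gt0.
have P0 : 0 < 2 `^ p :> R by rewrite powR_gt0.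
have [z [/andP[z0 _] zC]] : exists z, 0 < z <= 1 /\
    z `^ (p - 1) * Ct `^ p <= (2 `^ p)^-1 / 2 / 2.
  by apply: small_power => //; rewrite ?powR_ge0// !divr_gt0// invr_gt0.
pose e := z^-1; have e0 : 0 < e by rewrite invr_gt0.
pose S := 2 `^ p * Num.max SN 1 `^ p.
have S0 : 0 <= S by rewrite mulr_ge0 ?powR_ge0.
pose A := 2 * S / ((2 `^ p)^-1 / 2) * (1 + e) * 2 `^ p.
have A0 : 0 <= A.
  have D0 : 0 <= (2 `^ p)^-1 / 2 :> R by rewrite divr_ge0// invr_ge0 ltW.
  have E0 : 0 <= 1 + e by rewrite addr_ge0// ltW.
  apply: mulr_ge0 (ltW P0); apply: mulr_ge0 E0; apply: mulr_ge0;
    first exact: mulr_ge0.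
  by rewrite invr_ge0.
have [g0 [/andP[g00 g01] gA]] : exists g,
  0 < g <= 1 /\ g `^ (p - 1) * A <= 2^-1.
  by apply: small_power => //; rewrite invr_gt0.
have V0 : 0 <= Rintegral (@leb R n)
    (Omega : set (caratheodory_type (@leb_outer_measure R n))) v.
  by apply: Rintegral_ge0 => x Ox; case: weight_v => _; exact.
set V := Rintegral _ _ _ in V0.
pose B := 2 `^ p * 2 `^ p * (1 + 2 `^ p) * V.
have B0 : 0 <= B by rewrite !mulr_ge0 ?powR_ge0 ?addr_ge0.
have [y [/andP[y0 y1] yB]] : exists y,
  0 < y <= 1 /\ y `^ r * ((2 * r) `^ r * B) <= 2^-1.
  by apply: small_power; rewrite ?mulr_ge0 ?powR_ge0 ?invr_gt0.
(* y <= 1 gives m >= 2, and 1/m = y/2 <= y keeps the smallness obtained for y. *)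
pose m := 2 / y.
have m2 : 2 <= m by rewrite ler_pdivlMr// ler_piMr.
have m0 : 0 < m by apply: lt_le_trans m2.
have mB : m^-1 `^ r * (2 * r) `^ r * B <= 2^-1.
  apply: le_trans yB; rewrite -mulrA ler_wpM2r ?mulr_ge0 ?powR_ge0//.
  rewrite powR_homo ?(ltW r_gt0) ?invr_ge0 ?(ltW m0)//.
  by rewrite /m invf_div ler_pdivrMr// ler_peMr ?ler1n// ltW.
have SA : 2 * S / ((2 `^ p)^-1 / 2) * ((1 + e) * g0 `^ (p - 1) * 2 `^ p) <=
  2^-1.
  by apply: le_trans gA; rewrite le_eqVlt; apply/orP; left; apply/eqP;
    rewrite /A; ring.
have eC : e^-1 `^ (p - 1) * Ct `^ p <= (2 `^ p)^-1 / 2 / 2 by rewrite invrK.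
pose C := m / (p * (g0 / 2)).
have C0 : 0 < C by rewrite divr_gt0// mulr_gt0// divr_gt0.
exists C; split => // Q k mQ pQ _ sub sob f g fL gL u du.
have [mt _ _] := sub; have [mf fy] := fL; have [mg gy] := gL.
have mT M (w : 'rV[R]_n.+1 -> R) : measurable_on Omega w ->
    measurable_on Omega (fun x => trunc_pow p M (w x)).
  by move=> mw; exact: (measurableT_comp (@measurable_trunc_pow R p M) mw).
have mTN M (w : 'rV[R]_n.+1 -> R) : measurable_on Omega w ->
    measurable_on Omega (fun x => - trunc_pow p M (w x)).
  by move=> mw; exact: (measurable_funN (mT M w mw)).
have tM M s : 0 < M -> `|trunc_pow p M s| <= M `^ (p - 1).
  by move=> M0; apply: trunc_pow_le => //; exact: ltW.
have subE M : 0 < M -> (Linf_norm Omega v f < M%:E)%E ->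
  (Linf_norm Omega v g < M%:E)%E ->
    weak_subsolution Omega v Q p t f g u du ->
    (integral_on Omega (fun x => H_exp r (Num.max (u x) 0 / (C * M)) * v x)%R
     <= (2^-1)%:E)%E.
  move=> M0 fM gM wsub.
  apply: (real_subsolution_exp oO p_gt1 weight_v integrable_v mQ pQ r_gt0 sub
    sob M0
    g00 g01 e0 m2 eC SA mB wsub.1 (mT M f mf) (mT M g mg)).
  - by move=> x; exact: tM.
  - by move=> x; exact: tM.
  - exact: (weak_subsolution_real oO weight_v mt mf mg fM gM wsub).
have supE M : 0 < M -> (Linf_norm Omega v f < M%:E)%E ->
  (Linf_norm Omega v g < M%:E)%E ->
    weak_supersolution Omega v Q p t f g u du ->
    (integral_on Omega (fun x => H_exp r (Num.max (- u x) 0 / (C * M)) * v x)%R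
     <= (2^-1)%:E)%E.
  move=> M0 fM gM wsup.
  apply: (real_subsolution_exp oO p_gt1 weight_v integrable_v mQ pQ r_gt0 sub
    sob M0
    g00 g01 e0 m2 eC SA mB (in_QH10N oO wsup.1) (mTN M f mf) (mTN M g mg)).
  - by move=> x; rewrite normrN; exact: tM.
  - by move=> x; rewrite normrN; exact: tM.
  - exact: (weak_supersolution_real oO weight_v mt mf mg fM gM wsup).
have half1 : ((2^-1)%:E <= 1 :> \bar R)%E by rewrite lee_fin invf_le1// ler1n.
have posE s : `|Num.max s 0| = Num.max s 0 :> R.
  by rewrite ger0_norm// le_max lexx orbT.
split.
- move=> wsub; apply: LPhi_norm_le => // M M0 fM gM.
  by apply: le_trans half1; under eq_fun do rewrite posE; exact: subE.
- move=> wsup; apply: LPhi_norm_le => // M M0 fM gM.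
  by apply: le_trans half1; under eq_fun do rewrite posE; exact: supE.
move=> [QHu sol].
have wsub : weak_subsolution Omega v Q p t f g u du.
  by split => // phi Lphi _; rewrite sol.
have wsup : weak_supersolution Omega v Q p t f g u du.
  by split => // phi Lphi _; rewrite sol.
have [[mu uy] _ _] := QHu.
have uE : (LPhi_norm Omega v (H_exp r) u <=
    C%:E * (Linf_norm Omega v f + Linf_norm Omega v g))%E.
  apply: LPhi_norm_le => // M M0 fM gM.
  have h1 := subE M M0 fM gM wsub; have h2 := supE M M0 fM gM wsup.
  have mO := measurable_open oO.
  have [mv v0] := weight_v.
  pose H (w : 'rV[R]_n.+1 -> R) x := H_exp r (Num.max (w x) 0 / (C * M)) * v x.
  have mH w : measurable_on Omega w -> measurable_on Omega (H w).
    move=> mw; apply: (measurable_funM _ mv).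
    apply: (measurableT_comp (@measurable_H_exp R r)).
    apply: (measurable_funM _ (measurable_cst _)).
    by apply: (measurable_maxr (g := cst 0)) => //; exact: measurable_cst.
  have H0 w x : Omega x -> 0 <= H w x by move=> Ox;
    rewrite mulr_ge0 ?H_exp_ge0 ?v0.
  have mHu := mH _ mu; have mHNu := mH _ (measurable_funN mu).
  have CM : 0 < C * M by rewrite mulr_gt0.
  (* At each point |u| is u^+ or u^-, and the other term is nonnegative; the two integrals
     contribute 1/2 each. *)
  apply: (@le_trans _ _ (\int[@leb R n]_(x in Omega) ((H u x)%:E +
    (H (\- u) x)%:E))%E).
    apply: ge0_le_integral; first exact: mO.
    - by move=> x Ox; rewrite lee_fin mulr_ge0 ?H_exp_ge0 ?v0.
    - apply/measurable_EFinP; apply: (measurable_funM _ mv).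
      apply: (measurableT_comp (@measurable_H_exp R r)).
      apply: (measurable_funM _ (measurable_cst _)).
      exact: (measurableT_comp (@normr_measurable R setT) mu).
    - by apply: emeasurable_funD; exact/measurable_EFinP.
    - move=> x Ox; rewrite -EFinD lee_fin.
      have [u0|u0] := leP 0 (u x).
        by rewrite ger0_norm// {1}/H max_l// lerDl H0.
      by rewrite ltr0_norm// {2}/H max_l ?oppr_ge0 ?(ltW u0)// lerDr H0.
  rewrite ge0_integralD; last 5 first.
  - exact: mO.
  - by move=> x Ox; rewrite lee_fin H0.
  - exact/measurable_EFinP.
  - by move=> x Ox; rewrite lee_fin H0.
  - exact/measurable_EFinP.
  apply: (@le_trans _ _ ((2^-1)%:E + (2^-1)%:E)%E); first exact: leeD h1 h2.
  by rewrite -EFinD lee_fin -[2^-1]mul1r -splitr.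
split => //; split => //; apply: le_lt_trans uE _.
have := Linf_norm_ge0 Omega v f; have := Linf_norm_ge0 Omega v g; move: fy gy.
case: (Linf_norm Omega v f) => [a| |]//;
  case: (Linf_norm Omega v g) => [b| |]//.
by move=> _ _ _ _; rewrite -EFinD -EFinM ltry.
Qed.
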